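(* Let $n\ge 2$ be an integer and let $p$ be a prime with $p\ge n$. Then the $p$-local representation zeta function of $M_n$ is $$\zeta^{irr}_{M_n,p}(s)=\frac{(1-p^{-s})^2}{(1-p^{(n-2)-s})(1-p^{1-s})}.$$
   Context: $M_n=\langle a_1,\dots,a_n,b \mid [a_i,b]=a_{i+1}\ (1\le i\le n-1)\rangle$, where by convention all commutators of generators that do not appear in (or follow from) the relations are trivial (so the $a_i$ commute pairwise and $a_n$ is central). Representations are finite-dimensional complex representations. For a 1-dimensional representation $\chi$ and a representation $\rho$ of a group $G$, $\chi\otimes\rho$ is called a twist of $\rho$. Two irreducible representations $\rho,\rho_*$ are twist-equivalent if $\chi\otimes\rho\cong\rho_*$ for some 1-dimensional representation $\chi$; the equivalence classes are called twist isoclasses, and the dimension of a twist isoclass is the dimension of any of its members. For a finitely generated torsion-free nilpotent group $G$, $r_m(G)$ denotes the (finite) number of twist isoclasses of irreducible $m$-dimensional representations of $G$. The $p$-local representation zeta function is $\zeta^{irr}_{G,p}(s)=\sum_{N=0}^{\infty} r_{p^N}(G)\,p^{-Ns}$. The asserted equality may be read as an identity of power series in $p^{-s}$, or as an identity of functions of $s\in\mathbb{C}$ with $\Re(s)$ sufficiently large. *)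

(* Defs.v *)
From HB Require Import structures.
From mathcomp Require Import all_boot all_order all_algebra.
From mathcomp Require Import complex finmap.
From mathcomp Require Import all_classical all_reals all_analysis.
Set Implicit Arguments.
Unset Strict Implicit.
Unset Printing Implicit Defensive.
Import Order.TTheory GRing.Theory Num.Theory.
Import numFieldNormedType.Exports.
Local Open Scope fset_scope.
Local Open Scope classical_set_scope.
Local Open Scope quotient_scope.
Local Open Scope complex_scope.
Local Open Scope ring_scope.

(* Groups given by generators and relations: group words over X modulo the    *)
(* congruence generated by the group axioms and the relations.                *)

Inductive gword (X : Type) : Type :=
| GGen of X
| GOne
| GMul of gword X & gword X
| GInv of gword X.
Arguments GOne {X}.

HB.instance Definition _ (X : Type) := gen_eqMixin (gword X).
HB.instance Definition _ (X : Type) := gen_choiceMixin (gword X).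

(* The commutator convention [x, y] = x^-1 y^-1 x y is the one of commg.      *)
Definition gcomm (X : Type) (x y : gword X) : gword X :=
  GMul (GInv x) (GMul (GInv y) (GMul x y)).

Section Presentation.
Variables (X : Type) (rel : gword X -> gword X -> Prop).

Inductive gcong : gword X -> gword X -> Prop :=
| gcong_rel u v : rel u v -> gcong u v
| gcong_refl u : gcong u u
| gcong_sym u v : gcong u v -> gcong v u
| gcong_trans v u w : gcong u v -> gcong v w -> gcong u w
| gcong_mul u u' v v' : gcong u u' -> gcong v v' -> gcong (GMul u v) (GMul u' v')
| gcong_inv u u' : gcong u u' -> gcong (GInv u) (GInv u')
| gcong_mulA u v w : gcong (GMul u (GMul v w)) (GMul (GMul u v) w)
| gcong_mul1 u : gcong (GMul GOne u) u
| gcong_mulV u : gcong (GMul (GInv u) u) GOne.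

Definition gcongb (u v : gword X) : bool := `[< gcong u v >].

Lemma gcongb_refl : reflexive gcongb.
Proof. by move=> u; apply/asboolP; exact: gcong_refl. Qed.

Lemma gcongb_sym : symmetric gcongb.
Proof. by move=> u v; apply/asboolP/asboolP; exact: gcong_sym. Qed.

Lemma gcongb_trans : transitive gcongb.
Proof.
by move=> v u w /asboolP uv /asboolP vw; apply/asboolP; exact: gcong_trans vw.
Qed.

Canonical gcong_equiv : equiv_rel (gword X) :=
  EquivRel gcongb gcongb_refl gcongb_sym gcongb_trans.

Definition presented := {eq_quot gcong_equiv}.

HB.instance Definition _ := Choice.on presented.
HB.instance Definition _ := EqQuotient.on presented.

Lemma presentedP (u v : gword X) :
  \pi_presented u = \pi_presented v <-> gcong u v.
Proof. by split=> [/eqmodP/asboolP //|uv]; apply/eqmodP/asboolP. Qed.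

Lemma gcong_repr (u : gword X) : gcong (repr (\pi_presented u)) u.
Proof. by apply/presentedP; rewrite reprK. Qed.

Definition pgen (x : X) : presented := \pi_presented (GGen x).
Definition pone : presented := \pi_presented GOne.
Definition pmul (x y : presented) : presented :=
  \pi_presented (GMul (repr x) (repr y)).
Definition pinv (x : presented) : presented := \pi_presented (GInv (repr x)).

Lemma pi_pmul (u v : gword X) :
  \pi_presented (GMul u v) = pmul (\pi_presented u) (\pi_presented v).
Proof.
by apply/presentedP/gcong_sym/gcong_mul; exact: gcong_repr.
Qed.

Lemma pi_pinv (u : gword X) :
  \pi_presented (GInv u) = pinv (\pi_presented u).
Proof. by apply/presentedP/gcong_sym/gcong_inv; exact: gcong_repr. Qed.

Lemma pmulA : associative pmul.
Proof.
move=> x y z; rewrite -[x]reprK -[y]reprK -[z]reprK.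
move: (repr x) (repr y) (repr z) => u v w.
rewrite -(pi_pmul v w) -(pi_pmul u v) -(pi_pmul u) -(pi_pmul _ w).
by apply/presentedP; exact: gcong_mulA.
Qed.

Lemma pmul1 : left_id pone pmul.
Proof.
move=> x; rewrite -[x]reprK; move: (repr x) => u.
by rewrite -(pi_pmul _ u); apply/presentedP; exact: gcong_mul1.
Qed.

Lemma pmulV : left_inverse pone pinv pmul.
Proof.
move=> x; rewrite -[x]reprK; move: (repr x) => u.
rewrite -pi_pinv -(pi_pmul _ u); by apply/presentedP; exact: gcong_mulV.
Qed.

Lemma pmulVr : right_inverse pone pinv pmul.
Proof.
move=> x; rewrite -[LHS]pmul1 -(pmulV (pinv x)) -pmulA [pmul (pinv x) _]pmulA.
by rewrite pmulV pmul1.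
Qed.

Lemma pmul1r : right_id pone pmul.
Proof. by move=> x; rewrite -(pmulV x) pmulA pmulVr pmul1. Qed.

HB.instance Definition _ :=
  isGroup.Build presented pmulA pmul1 pmul1r pmulV pmulVr.

End Presentation.

(* M_n = < a_1, ..., a_n, b | [a_i, b] = a_{i+1} for 1 <= i <= n - 1 >, with   *)
(* the convention that all other commutators of generators are trivial.       *)
(* The generator [Some i], with i : 'I_n, is a_{i+1}, and [None] is b.        *)
Definition Mgen (n : nat) : Type := option 'I_n.

Variant Mrel (n : nat) : gword (Mgen n) -> gword (Mgen n) -> Prop :=
| Mrel_ab (i j : 'I_n) : (j = i.+1 :> nat) ->
    Mrel (gcomm (GGen (Some i)) (GGen None)) (GGen (Some j))
| Mrel_anb (i : 'I_n) : (i.+1 = n) ->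
    Mrel (gcomm (GGen (Some i)) (GGen None)) GOne
| Mrel_aa (i j : 'I_n) :
    Mrel (gcomm (GGen (Some i)) (GGen (Some j))) GOne.

Definition Mgroup (n : nat) : groupType := presented (@Mrel n).

(* Matrices act on column vectors from the left. *)
Record representation (R : realType) (G : groupType) (m : nat) :=
  Representation {
    repr_mx :> G -> 'M[R[i]]_m;
    repr_mx1 : repr_mx 1%g = 1%:M;
    repr_mxM : forall x y : G, repr_mx (x * y)%g = repr_mx x *m repr_mx y
  }.

Section Representations.
Variables (R : realType) (G : groupType).

Definition irreducible_repr (m : nat) (rho : representation R G m) : Prop :=
  (0 < m)%N /\
  forall W : {vspace 'cV[R[i]]_m},
    (forall (g : G) (v : 'cV[R[i]]_m), v \in W -> rho g *m v \in W) ->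
    W = 0%VS \/ W = fullv.

Definition iso_repr (m : nat) (rho sigma : representation R G m) : Prop :=
  exists2 P : 'M[R[i]]_m, P \in unitmx &
    forall g : G, P *m rho g = sigma g *m P.

Section Twist.
Variables (m : nat) (chi : representation R G 1) (rho : representation R G m).

(* chi (x) rho, with C (x) C^m identified with C^m *)
Definition twist_mx (g : G) : 'M[R[i]]_m := chi g 0 0 *: rho g.

Lemma twist_mx1 : twist_mx 1%g = 1%:M.
Proof. by rewrite /twist_mx !repr_mx1 mxE eqxx scale1r. Qed.

Lemma twist_mxM (x y : G) : twist_mx (x * y)%g = twist_mx x *m twist_mx y.
Proof.
rewrite /twist_mx !repr_mxM -scalemxAl -scalemxAr scalerA; congr (_ *: _).
by rewrite mxE big_ord1.
Qed.

Definition twist : representation R G m := Representation twist_mx1 twist_mxM.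

End Twist.

Definition twist_equiv (m : nat) (rho sigma : representation R G m) : Prop :=
  exists chi : representation R G 1, iso_repr (twist chi rho) sigma.

Definition twist_isoclass (m : nat) (rho : representation R G m) :
    set (representation R G m) :=
  [set sigma | irreducible_repr sigma /\ twist_equiv rho sigma].

Definition twist_isoclasses (m : nat) : set (set (representation R G m)) :=
  [set twist_isoclass rho | rho in [set rho | @irreducible_repr m rho]].
Arguments twist_isoclasses : clear implicits.

(* The number r_m(G); the value is meaningful only if [twist_isoclasses m] is *)
(* finite (fset_set sends infinite sets to the empty set).                    *)
Definition num_twist_isoclasses (m : nat) : nat :=
  #|` fset_set (twist_isoclasses m)|.

End Representations.
Arguments twist_isoclasses : clear implicits.
Arguments num_twist_isoclasses : clear implicits.

(* The library has no complex exponential: e^(x + iy) = e^x (cos y + i sin y).*)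
Definition cexp (R : realType) (z : R[i]) : R[i] :=
  (expR (complex.Re z))%:C * (cos (complex.Im z) +i* sin (complex.Im z)).

Definition cpow (R : realType) (k : nat) (s : R[i]) : R[i] :=
  cexp (s * (ln (k%:R : R))%:C).

Definition zeta_irr_terms (R : realType) (G : groupType) (p : nat) (s : R[i]) :
    (R[i]^o)^nat :=
  fun N => (num_twist_isoclasses R G (p ^ N))%:R * cpow p (- (N%:R * s)).

Definition zeta_irr (R : realType) (G : groupType) (p : nat) (s : R[i]) : R[i] :=
  limn (series (zeta_irr_terms G p s)).

(* Main.v *)
(* Let T act on characters lam = (lam_1, ..., lam_n) of A = <a_1, ..., a_n> by  *)
(* (T lam)_i = lam_i lam_(i+1), with lam_(n+1) = 1: the generator b maps the    *)
(* lam-eigenspace of A to the (T lam)-eigenspace. An irreducible representation *)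
(* of dimension m is therefore spanned by v, bv, ..., b^(m-1) v, where v has a  *)
(* character lam of T-period exactly m, and up to isomorphism it is determined  *)
(* by the orbit of lam and by the scalar b^m. Twisting changes lam_1 and b^m    *)
(* arbitrarily, so twist isoclasses correspond to T-orbits of the tails         *)
(* (lam_2, ..., lam_n). Since p >= n, the binomials C(p^k, j) with 0 < j < n    *)
(* are divisible by p^k, whence T^(p^k) lam = lam iff lam_2, ..., lam_n are     *)
(* p^k-th roots of unity. For m = p^N one counts the orbits of T on the tails   *)
(* of exact exponent p^N: the orbit of such a tail has length p^k, where p^k is *)
(* the exponent of (lam_3, ..., lam_n). With q = p^(n-2) the number of orbits   *)
(* is the convolution of (q^k - q^(k-1))_k and (p^k - p^(k-1))_k, read as 1 for *)
(* k = 0; these are the coefficients of (1 - x)/(1 - q x) and (1 - x)/(1 - p x),*)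
(* to be evaluated at x = p^(-s).                                               *)
Require Import Defs.
From mathcomp Require Import all_boot all_order all_algebra.
From mathcomp Require Import complex finmap.
From mathcomp Require Import cyclic separable cyclotomic.
From mathcomp Require Import all_classical all_reals all_analysis.
From mathcomp Require Import ring lra zify.
Import Order.TTheory GRing.Theory Num.Theory.
Import numFieldNormedType.Exports.
Local Open Scope classical_set_scope.
Local Open Scope complex_scope.
Local Open Scope ring_scope.
Set Implicit Arguments.
Unset Strict Implicit.
Unset Printing Implicit Defensive.

(** An irreducible representation of dimension p^N is a sum of one-dimensional joint eigenspaces of
    the a_i, permuted cyclically by b ([orbit_basis]). Twisting normalises the first eigenvalue and
    the scalar b^(p^N), so that only the T-orbit of the tail (lam_2, ..., lam_n) survives
    ([twist_equiv_model], [model_twist_inv]).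

    Because p >= n, [char_shift_pfactorP] turns p-power periods of T into orders of roots of unity.
    It is used twice: on lam, where the period p^N means that the tail has exponent exactly p^N, and
    on the tail itself, whose orbit has length p^k when (lam_3, ..., lam_n) has exponent exactly
    p^k. Powers of a primitive p^N-th root of unity turn tails into vectors over Z/p^N. Counting the
    vectors with a given k and dividing by p^k yields the convolution of [card_orbit_reps], hence
    [num_twist_isoclassesE].

    The series is then a Cauchy product of two nearly geometric series. A first-order recurrence
    gives its partial sums with an explicit error ([sum_zeta_term_error]), which decays
    geometrically when Re(s) is large ([sum_zeta_term_bound]). *)

(** * Periods of iterated maps and divisibility of binomials *)

Lemma iter_gcdn (T : Type) (f : T -> T) (x : T) (a b : nat) :
  iter a f x = x -> iter b f x = x -> iter (gcdn a b) f x = x.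
Proof.
have itM c d : iter c f x = x -> iter (d * c) f x = x.
  by move=> fx; elim: d => // d IH; rewrite mulSn iterD IH.
case: (posnP a) => [->|a0 fa fb]; first by rewrite gcd0n.
(* Bezout in the subtraction-free form u a = v b + gcd(a, b). *)
case: (egcdnP b a0) => u v uv _.
by have := itM _ u fa; rewrite uv addnC iterD itM.
Qed.

Lemma iter_cancel (T : Type) (P : T -> Prop) (f : T -> T) (x : T) (a b : nat) :
  (forall y, P y -> P (f y)) ->
  (forall y z, P y -> P z -> f y = f z -> y = z) ->
  P x -> (a <= b)%N -> iter a f x = iter b f x -> iter (b - a) f x = x.
Proof.
move=> Pf finj Px ab; rewrite -{1}(subnKC ab) iterD => /esym.
have itP c : P (iter c f x) by elim: c => //= c; apply: Pf.
elim: a {ab} (b - a)%N => //= a IH d /finj e; apply: IH; apply: e => //.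
  by rewrite -iterD.
Qed.

(** With q = p^j, the identity l C(q, l) = q C(q - 1, l - 1) suffices, since l is prime to p. *)
Lemma dvdn_bin_pfactor (p j l : nat) : prime p -> (0 < l < p)%N ->
  (p ^ j %| 'C(p ^ j, l))%N.
Proof.
move=> pp /andP[l0 lp]; case: l l0 lp => // l _ lp.
rewrite -(@Gauss_dvdr _ l.+1); last first.
  apply: coprimeXl; rewrite prime_coprime // gtnNdvd //.
by rewrite -mul_bin_diag dvdn_mulr.
Qed.

(** * Dynamics of the action of b on characters *)

Section CharacterShift.
Variable F : fieldType.
Implicit Types lam mu : nat -> F.

Definition char_shift lam : nat -> F := fun i => lam i * lam i.+1.

(** In additive notation T is 1 + (index shift), so this is the binomial theorem; the induction is
    Pascal's rule. *)
Lemma iter_char_shiftE k lam i :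
  iter k char_shift lam i = \prod_(j < k.+1) lam (i + j)%N ^+ 'C(k, j).
Proof.
elim: k i => [|k IH] i /=; first by rewrite big_ord1 addn0 expr1.
rewrite {1}/char_shift !IH [RHS]big_ord_recl bin0 expr1 addn0.
under [in RHS]eq_bigr => j _ do rewrite lift0 binS exprD.
rewrite big_split /= big_ord_recl bin0 expr1 addn0 -!mulrA; congr (_ * _).
rewrite [X in _ = X * _]big_ord_recr /= bin_small // expr0 mulr1.
by congr (_ * _); apply: eq_bigr => j _; rewrite // addSnnS.
Qed.

(* A character of the group generated by a_1, ..., a_n, indexed from 0 and *)
(* extended by 1.                                                         *)
Definition char_of_rank n lam :=
  (forall i, lam i != 0) /\ (forall i, (n <= i)%N -> lam i = 1).

Lemma char_shift_rank n lam : char_of_rank n lam -> char_of_rank n (char_shift lam).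
Proof.
move=> [l0 l1]; split=> i; first by rewrite mulf_neq0.
by move=> ni; rewrite /char_shift !l1 ?mulr1 // ltnW.
Qed.

Lemma iter_char_shift_rank n lam k :
  char_of_rank n lam -> char_of_rank n (iter k char_shift lam).
Proof. by move=> h; elim: k => //= k IH; exact: char_shift_rank. Qed.

(** Coordinates are recovered from the top down: those of index at least n are 1, and each lower one
    is found by dividing by its successor. *)
Lemma char_shift_inj n lam mu : char_of_rank n lam -> char_of_rank n mu ->
  char_shift lam = char_shift mu -> lam = mu.
Proof.
move=> [l0 l1] [m0 m1] e; apply/funext => i.
suff: forall d i, (n <= i + d)%N -> lam i = mu i by apply; exact: leq_addl.
elim=> {i} [|d IH] i; first by rewrite addn0 => ni; rewrite l1 // m1.
rewrite addnS -addSn => /IH ei; apply: (mulIf (l0 i.+1)).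
by rewrite {2}ei; exact: (congr1 (fun h => h i) e).
Qed.

(** In the expansion of T^q with q = p^j, the exponents C(q, l) with 0 < l < p are multiples of q,
    while factors with l >= p sit at indices beyond n and equal 1. This is where p >= n enters. *)
Lemma char_shift_pfactorP n p j lam : prime p -> (n <= p)%N -> char_of_rank n lam ->
  iter (p ^ j) char_shift lam = lam <-> forall i, lam i.+1 ^+ (p ^ j) = 1.
Proof.
move=> pp np [l0 l1]; set q := (p ^ j)%N.
have term i l : lam (i + l.+1)%N ^+ q = 1 -> lam (i + l.+1)%N ^+ 'C(q, l.+1) = 1.
  move=> h; case: (ltnP l.+1 p) => lp; last first.
    by rewrite l1 ?expr1n // (leq_trans np) // (leq_trans lp) ?leq_addl.
  case/dvdnP: (@dvdn_bin_pfactor p j l.+1 pp lp) => c ->.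
  by rewrite mulnC exprM h expr1n.
split=> [e i|h]; last first.
  apply/funext => i; rewrite iter_char_shiftE big_ord_recl bin0 expr1 addn0.
  by rewrite big1 ?mulr1 // => l _; apply: term; rewrite addnS.
(* Descending induction on the index: once the coordinates above i + 1 are q-torsion, the equation
   at i reduces to lam_(i+1)^q = 1. *)
suff: forall d i, (n <= i.+1 + d)%N -> forall k, (i <= k)%N -> lam k.+1 ^+ q = 1.
  by move=> H; apply: (H n i) => //; exact: leq_addl.
elim=> {i} [|d IH] i.
  by rewrite addn0 => ni k ik; rewrite l1 ?expr1n // (leq_trans ni).
rewrite addnS -addSn => /IH {}IH k; rewrite leq_eqVlt => /orP[/eqP <-|]; last exact: IH.
have := congr1 (fun h => h i) e; rewrite iter_char_shiftE -/q => {e}.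
have : (0 < q)%N by rewrite expn_gt0 prime_gt0.
move: q term IH => [//|q] term IH _.
rewrite big_ord_recl bin0 expr1 addn0 big_ord_recl lift0 bin1 addn1.
rewrite big1 => [|l _]; last first.
  by rewrite !lift0; apply: term; rewrite addnS IH // addnS ltnS leq_addr.
by rewrite mulr1 -[RHS]mulr1 => /(mulfI (l0 i)).
Qed.
End CharacterShift.

(** * Representations and twists *)

Section Presentation.
Variables (R : realType) (X : Type) (rel : gword X -> gword X -> Prop).
Variable m : nat.
Local Notation G := (presented rel).

Lemma presented_ind (Q : G -> Prop) :
  (forall x, Q (pgen rel x)) -> Q 1%g -> (forall x y, Q x -> Q y -> Q (x * y)%g) ->
  (forall x, Q x -> Q (x^-1)%g) -> forall g, Q g.
Proof.
move=> Qgen Q1 QM QV g; rewrite -[g]reprK.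
elim: (repr g) => [x||u Qu v Qv|u Qu]; first exact: Qgen.
- exact: Q1.
- by rewrite pi_pmul; exact: QM.
- by rewrite pi_pinv; exact: QV.
Qed.

Fixpoint word_mx (M : X -> 'M[R[i]]_m) (w : gword X) : 'M[R[i]]_m :=
  match w with
  | GGen x => M x
  | GOne => 1%:M
  | GMul u v => word_mx M u *m word_mx M v
  | GInv u => invmx (word_mx M u)
  end.

Variable M : X -> 'M[R[i]]_m.
Hypothesis M_unit : forall x, M x \in unitmx.
Hypothesis M_rel : forall u v, rel u v -> word_mx M u = word_mx M v.

Lemma word_mx_unit w : word_mx M w \in unitmx.
Proof.
elim: w => [x||u Qu v Qv|u Qu] /=; first exact: M_unit.
- exact: unitmx1.
- by rewrite unitmx_mul Qu.
- by rewrite unitmx_inv.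
Qed.

(** Unit matrices satisfying the relations respect the whole congruence, so they define a
    representation of the presented group. *)
Lemma word_mx_cong u v : gcong rel u v -> word_mx M u = word_mx M v.
Proof.
elim=> /= {u v} [u v|u|u v _ ->|v u w _ -> _ ->|u u' v v' _ -> _ ->|u u' _ ->|u v w|u|u] //.
- exact: M_rel.
- by rewrite mulmxA.
- by rewrite mul1mx.
- by rewrite mulVmx // word_mx_unit.
Qed.

Lemma presented_repr1 : word_mx M (repr (1%g : G)) = 1%:M.
Proof. exact: (word_mx_cong (gcong_repr _ _)). Qed.

Lemma presented_reprM (x y : G) :
  word_mx M (repr (x * y)%g) = word_mx M (repr x) *m word_mx M (repr y).
Proof. exact: (word_mx_cong (gcong_repr _ _)). Qed.

Definition presented_repr : representation R G m :=
  Representation presented_repr1 presented_reprM.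

Lemma presented_repr_gen x : presented_repr (pgen rel x) = M x.
Proof. exact: (word_mx_cong (gcong_repr _ _)). Qed.

End Presentation.

Section RepresentationTheory.
Variables (R : realType) (G : groupType) (m : nat).
Implicit Types (rho sigma tau : representation R G m) (chi psi : representation R G 1).

Lemma repr_mulV rho g : rho g *m rho (g^-1)%g = 1%:M.
Proof. by rewrite -repr_mxM mulgV repr_mx1. Qed.

Lemma repr_mulVl rho g : rho (g^-1)%g *m rho g = 1%:M.
Proof. by rewrite -repr_mxM mulVg repr_mx1. Qed.

Lemma repr_unit rho g : rho g \in unitmx.
Proof. by case: (mulmx1_unit (repr_mulV rho g)). Qed.

Lemma char_mx1 chi : chi 1%g 0 0 = 1.
Proof. by rewrite repr_mx1 mxE eqxx. Qed.

Lemma char_mxM chi x y : chi (x * y)%g 0 0 = chi x 0 0 * chi y 0 0.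
Proof. by rewrite repr_mxM mxE big_ord1. Qed.

Lemma char_mx_neq0 chi x : chi x 0 0 != 0.
Proof.
apply/eqP => z; have := char_mx1 chi; rewrite -(mulgV x) char_mxM z mul0r.
by move/eqP; rewrite eq_sym oner_eq0.
Qed.

Section LinearCharacter.
Variable f : G -> R[i].
Hypotheses (f1 : f 1%g = 1) (fM : forall x y, f (x * y)%g = f x * f y).

Lemma linear_char1 : (f 1%g)%:M = 1%:M :> 'M[R[i]]_1. Proof. by rewrite f1. Qed.
Lemma linear_charM x y : (f (x * y)%g)%:M = (f x)%:M *m (f y)%:M :> 'M[R[i]]_1.
Proof. by rewrite fM scalar_mxM. Qed.

Definition linear_char : representation R G 1 :=
  @Representation R G 1 (fun g => (f g)%:M) linear_char1 linear_charM.

Lemma linear_charE g : linear_char g 0 0 = f g.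
Proof. by rewrite mxE eqxx mulr1n. Qed.

End LinearCharacter.

Lemma twist_equiv_refl rho : twist_equiv rho rho.
Proof.
have e (x y : G) : (1 : R[i]) = 1 * 1 by rewrite mulr1.
exists (linear_char (f := fun=> 1) erefl e), 1%:M => [|g]; first exact: unitmx1.
by rewrite /= /twist_mx linear_charE scale1r mul1mx mulmx1.
Qed.

Lemma twist_equiv_sym rho sigma : twist_equiv rho sigma -> twist_equiv sigma rho.
Proof.
case=> chi [P Pu PE].
have f1 : (chi 1%g 0 0)^-1 = 1 by rewrite char_mx1 invr1.
have fM x y : (chi (x * y)%g 0 0)^-1 = (chi x 0 0)^-1 * (chi y 0 0)^-1.
  by rewrite char_mxM invfM.
exists (linear_char f1 fM), (invmx P) => [|g]; first by rewrite unitmx_inv.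
rewrite /= /twist_mx linear_charE.
apply: (can_inj (mulKmx Pu)); rewrite mulKVmx //.
have := PE g; rewrite /= /twist_mx => e.
rewrite -[LHS](mulmxK Pu) -[in LHS]scalemxAl -e -scalemxAr scalerA.
by rewrite mulVf ?char_mx_neq0 // scale1r mulmxA.
Qed.

Lemma twist_equiv_trans rho sigma tau :
  twist_equiv rho sigma -> twist_equiv sigma tau -> twist_equiv rho tau.
Proof.
case=> chi [P Pu PE] [psi [Q Qu QE]].
have f1 : chi 1%g 0 0 * psi 1%g 0 0 = 1 by rewrite !char_mx1 mulr1.
have fM x y : chi (x * y)%g 0 0 * psi (x * y)%g 0 0 =
   (chi x 0 0 * psi x 0 0) * (chi y 0 0 * psi y 0 0) by rewrite !char_mxM mulrACA.
exists (linear_char f1 fM), (Q *m P) => [|g]; first by rewrite unitmx_mul Qu.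
rewrite /= /twist_mx linear_charE.
have := QE g; have := PE g; rewrite /= /twist_mx => e1 e2.
rewrite mulmxA -e2 -!scalemxAr -scalemxAl -[Q *m sigma g *m P]mulmxA -e1.
by rewrite -!scalemxAr scalerA mulmxA mulrC.
Qed.

Lemma twist_isoclass_eq rho sigma : irreducible_repr rho -> irreducible_repr sigma ->
  twist_isoclass rho = twist_isoclass sigma <-> twist_equiv rho sigma.
Proof.
move=> rI sI; split=> [e|rs].
  have : twist_isoclass sigma sigma by split=> //; exact: twist_equiv_refl.
  by rewrite -e => -[].
apply/seteqP; split=> t [tI h]; split=> //.
  by apply: twist_equiv_trans h; exact: twist_equiv_sym.
exact: twist_equiv_trans h.
Qed.

End RepresentationTheory.

Lemma repr_intertwine (R : realType) (X : Type) (rel : gword X -> gword X -> Prop)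
    (m : nat) (rho sigma : representation R (presented rel) m) (P : 'M[R[i]]_m) :
  (forall x, P *m rho (pgen rel x) = sigma (pgen rel x) *m P) ->
  forall g, P *m rho g = sigma g *m P.
Proof.
move=> h; apply: presented_ind => // [|x y ex ey|x ex].
- by rewrite !repr_mx1 mul1mx mulmx1.
- by rewrite !repr_mxM mulmxA ex -!mulmxA ey.
rewrite -[LHS]mul1mx -(repr_mulVl sigma x) -mulmxA [X in _ *m X]mulmxA -ex.
by rewrite -!mulmxA repr_mulV mulmx1.
Qed.

(** Stability under inverses comes from finite dimension: an injective map sending W into W sends W
    onto W. *)
Lemma repr_stable (R : realType) (X : Type) (rel : gword X -> gword X -> Prop)
    (m : nat) (rho : representation R (presented rel) m) (W : {vspace 'cV[R[i]]_m}) :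
  (forall x v, v \in W -> rho (pgen rel x) *m v \in W) ->
  forall g v, v \in W -> rho g *m v \in W.
Proof.
move=> h; apply: presented_ind => // [v vW|x y hx hy v vW|x hx v vW].
- by rewrite repr_mx1 mul1mx.
- by rewrite repr_mxM -mulmxA; apply/hx/hy.
pose f : 'End('cV[R[i]]_m) := linfun (mulmx (rho x)).
have fE u : f u = rho x *m u by rewrite lfunE.
have kf : lker f == 0%VS.
  apply/lker0P => u w; rewrite !fE => /(congr1 (mulmx (rho (x^-1)%g))).
  by rewrite !mulmxA repr_mulVl !mul1mx.
have : (f @: W)%VS == W.
  rewrite -(geq_leqif (dimv_leqif_eq _)) ?limg_dim_eq ?(eqP kf) ?capv0 //.
  by apply/subvP => _ /memv_imgP[u uW ->]; rewrite fE hx.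
move/eqP => e; move: vW; rewrite -e => /memv_imgP[u uW ->].
by rewrite fE mulmxA repr_mulVl mul1mx e.
Qed.

(** * Separation of eigenspaces *)

Section LinearAlgebra.
Variable R : realType.
Local Notation C := R[i].

(** The linear factors of the characteristic polynomial are applied to v one after the other. By
    Cayley-Hamilton some factor kills the current vector, and the last nonzero one is an
    eigenvector. A predicate stable under all M - c plays the part of an invariant subspace. *)
Lemma eigenvector_in m (M : 'M[C]_m) (P : 'cV[C]_m -> Prop) (v : 'cV[C]_m) :
  (forall w c, P w -> P (M *m w - c *: w)) -> P v -> v != 0 ->
  exists u c, [/\ P u, u != 0 & M *m u = c *: u].
Proof.
case: m M P v => [|m] M P v PM Pv v0; first by rewrite flatmx0 eqxx in v0.
have [s sE] := closed_field_poly_normal (char_poly M).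
have {sE} : horner_mx M (\prod_(z <- s) ('X - z%:P)) *m v = 0.
  have := Cayley_Hamilton M; rewrite sE (monicP (char_poly_monic M)) scale1r => ->.
  by rewrite mul0mx.
elim: s v Pv v0 => [|a s IH] v Pv v0.
  by rewrite big_nil rmorph1 mul1mx => /eqP; rewrite (negPf v0).
rewrite big_cons mulrC rmorphM /= rmorphB /= horner_mx_X horner_mx_C.
rewrite -mulmxA mulmxBl mul_scalar_mx => e.
case: (eqVneq (M *m v - a *: v) 0) => [/eqP|w0]; last exact: IH (PM _ _ Pv) w0 e.
by rewrite subr_eq0 => /eqP Mv; exists v, a.
Qed.

Lemma common_eigenvector_nat m (A : nat -> 'M[C]_m) k : (0 < m)%N ->
  (forall i j, A i *m A j = A j *m A i) ->
  exists u lam, u != 0 /\ forall i, (i < k)%N -> A i *m u = lam i *: u :> 'cV_m.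
Proof.
move=> m0 comA; elim: k => [|k [v [lam [v0 vE]]]].
  exists (delta_mx (Ordinal m0) 0), (fun=> 0); split=> //.
  by apply/eqP => /matrixP /(_ (Ordinal m0) 0) /eqP; rewrite !mxE !eqxx oner_eq0.
have [|//|//|u [c [uE u0 uc]]] := @eigenvector_in _ (A k)
    (fun w => forall i, (i < k)%N -> A i *m w = lam i *: w) v.
  move=> w c wE i ik; rewrite mulmxBr mulmxA comA -mulmxA -scalemxAr !(wE i ik).
  by rewrite -scalemxAr scalerBr !scalerA [c * _]mulrC.
exists u, (fun i => if (i < k)%N then lam i else c); split=> // i.
rewrite ltnS leq_eqVlt => /orP[/eqP ->|ik]; rewrite ?ltnn ?ik; [|exact: uE]; exact: uc.
Qed.

(** Applying A_i - lam_l(i), for an i at which lam_j and lam_l differ, kills the l-th summand and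
    rescales the j-th by a nonzero factor; all l other than j are removed in turn. *)
Lemma eigen_separation m (A : nat -> 'M[C]_m) (W : {vspace 'cV[C]_m}) k
    (v : 'I_k -> 'cV[C]_m) (lam : 'I_k -> nat -> C) :
  (forall i w, w \in W -> A i *m w \in W) ->
  (forall j i, A i *m v j = lam j i *: v j) -> injective lam ->
  \sum_j v j \in W -> forall j, v j \in W.
Proof.
move=> WA vE lamI vW j.
suff /(_ (enum (predC1 j)))[|c [cW cj c0]] : forall s : seq 'I_k,
    j \notin s -> exists c : 'I_k -> C,
    [/\ \sum_l c l *: v l \in W, c j != 0 & {in s, forall l, c l = 0}].
- by rewrite mem_enum /= inE eqxx.
- move: cW; rewrite (bigD1 j) //= big1 => [|l lj]; last first.
    by rewrite c0 ?scale0r // mem_enum.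
  rewrite addr0 => /(memvZ (c j)^-1); by rewrite scalerA mulVf // scale1r.
elim=> [_|l s IH].
  by exists (fun=> 1); split=> //; under eq_bigr do rewrite scale1r.
rewrite inE negb_or => /andP[jl /IH[c [cW cj c0]]].
have [i li] : exists i, lam j i != lam l i.
  apply: contrapT => h; case/eqP: jl; apply/lamI/funext => i.
  by apply/eqP/negPn/negP => li; apply: h; exists i.
exists (fun r => c r * (lam r i - lam l i)); split.
- rewrite (_ : \sum__ _ = A i *m (\sum_r c r *: v r) - lam l i *: (\sum_r c r *: v r)).
    by rewrite memvB ?memvZ ?WA.
  rewrite mulmx_sumr scaler_sumr -sumrB; apply: eq_bigr => r _.
  by rewrite -scalemxAr vE !scalerA mulrBr scalerBl [lam l i * _]mulrC.
- by rewrite mulf_neq0 // subr_eq0.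
- by move=> r; rewrite inE => /orP[/eqP ->|/c0 ->]; rewrite ?subrr ?mulr0 ?mul0r.
Qed.

Definition fam_mx m k (v : 'I_k -> 'cV[C]_m) : 'M[C]_(m, k) := \matrix_(i, j) v j i 0.

Lemma mul_fam_mx m k r (v : 'I_k -> 'cV[C]_m) (X : 'M[C]_(r, m)) :
  X *m fam_mx v = fam_mx (fun j => X *m v j).
Proof. by apply/matrixP => i j; rewrite !mxE; apply: eq_bigr => l _; rewrite mxE. Qed.

(** Linear independence of eigenvectors is [eigen_separation] with W = 0. *)
Lemma eigen_row_free m (A : nat -> 'M[C]_m) k
    (v : 'I_k -> 'cV[C]_m) (lam : 'I_k -> nat -> C) :
  (forall j i, A i *m v j = lam j i *: v j) -> injective lam ->
  (forall j, v j != 0) -> row_free (fam_mx v)^T.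
Proof.
move=> vE lamI v0; apply: inj_row_free => a a0; apply/rowP => j; rewrite mxE.
have : \sum_l a 0 l *: v l \in (0%VS : {vspace 'cV[C]_m}).
  rewrite memv0; apply/eqP; apply/colP => i; rewrite mxE summxE.
  move/rowP/(_ i): a0; rewrite !mxE => a0; rewrite -[RHS]a0.
  by apply: eq_bigr => l _; rewrite !mxE.
move/(eigen_separation (A := A) (lam := lam)) => /(_ _ _ lamI j).
rewrite memv0 scaler_eq0 (negPf (v0 j)) orbF => h; apply/eqP/h.
  by move=> i w; rewrite memv0 => /eqP ->; rewrite mulmx0 mem0v.
by move=> l i; rewrite -scalemxAr vE !scalerA mulrC.
Qed.

Lemma stable_span m (M : 'M[C]_m) (X : seq 'cV[C]_m) (W : {vspace 'cV[C]_m}) :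
  (forall w, w \in X -> M *m w \in W) -> forall w, w \in <<X>>%VS -> M *m w \in W.
Proof.
move=> XW w wX; have : (linfun (mulmx M) @: <<X>> <= W)%VS.
  rewrite limg_span; apply/span_subvP => _ /mapP[x xX ->]; rewrite lfunE; exact: XW.
by move/subvP; apply; rewrite -[M *m w](lfunE (mulmx M)) memv_img.
Qed.

End LinearAlgebra.

(** * Irreducible representations of M_n *)

Section Mtuples.
Variables (R : realType) (n m : nat).
Local Notation C := R[i].

(* The images of the generators under a representation of [Mgroup n], with the *)
(* convention a_i = 1 for i >= n: the relations then hold for every index.     *)
Definition Mtuple (A : nat -> 'M[C]_m) (B : 'M[C]_m) : Prop :=
  [/\ forall i, A i \in unitmx, B \in unitmx,
      forall i j, A i *m A j = A j *m A i,
      forall i, A i *m B = B *m A i *m A i.+1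
    & forall i, (n <= i)%N -> A i = 1%:M].

Section OfTuple.
Variables (A : nat -> 'M[C]_m) (B : 'M[C]_m) (AB : Mtuple A B).

Definition Mgen_mx (x : Mgen n) : 'M[C]_m := if x is Some i then A i else B.

Lemma Mgen_mx_unit x : Mgen_mx x \in unitmx.
Proof. by case: AB => Au Bu _ _ _; case: x => [i|] /=; [exact: Au|]. Qed.

Lemma Mgen_mx_rel u v : Mrel u v -> word_mx Mgen_mx u = word_mx Mgen_mx v.
Proof.
case: AB => Au Bu AA ABE A1; case=> /= [i j ji|i ni|i j].
- by rewrite ji ABE -[B *m _ *m _]mulmxA mulKmx // mulKmx.
- by rewrite ABE ni (A1 n) // mulmx1 mulKmx // mulVmx.
- by rewrite [A i *m _]AA mulKmx // mulVmx.
Qed.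

Definition Mrepr : representation R (Mgroup n) m :=
  presented_repr Mgen_mx_unit Mgen_mx_rel.

End OfTuple.

Variable rho : representation R (Mgroup n) m.

Definition a_mx (i : nat) : 'M[C]_m :=
  if insub i is Some j then rho (pgen (@Mrel n) (Some j)) else 1%:M.
Definition b_mx : 'M[C]_m := rho (pgen (@Mrel n) None).

Lemma a_mxE (i : 'I_n) : a_mx i = rho (pgen (@Mrel n) (Some i)).
Proof. by rewrite /a_mx valK. Qed.

Lemma a_mx_ge i : (n <= i)%N -> a_mx i = 1%:M.
Proof. by move=> ni; rewrite /a_mx insubF // ltnNge ni. Qed.

Lemma repr_gcomm x y w : Mrel (gcomm (GGen x) (GGen y)) w ->
  rho (pgen (@Mrel n) x) *m rho (pgen (@Mrel n) y) =
  rho (pgen (@Mrel n) y) *m rho (pgen (@Mrel n) x) *m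
    rho (\pi_(presented (@Mrel n))%qT w).
Proof.
move=> /gcong_rel/presentedP <-; rewrite -!repr_mxM; congr (rho _).
rewrite /gcomm 3!pi_pmul !pi_pinv.
set gx := pgen _ x; set gy := pgen _ y.
change (gx * gy = gy * gx * (gx^-1 * (gy^-1 * (gx * gy))))%g.
by rewrite !mulgA mulgK mulgV mul1g.
Qed.

Lemma Mtuple_repr : Mtuple a_mx b_mx.
Proof.
have rho1 : rho (\pi_(presented (@Mrel n))%qT GOne) = 1%:M by exact: (repr_mx1 rho).
split.
- by move=> i; rewrite /a_mx; case: insub => [j|]; [exact: repr_unit|exact: unitmx1].
- exact: repr_unit.
- move=> i j; rewrite /a_mx; case: insub => [k|]; case: insub => [l|];
    rewrite ?mul1mx ?mulmx1 //.
  by rewrite (repr_gcomm (Mrel_aa k l)) rho1 mulmx1.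
- move=> i; case: (ltnP i n) => ni; last by rewrite !a_mx_ge ?mulmx1 ?mul1mx // ltnW.
  rewrite (a_mxE (Ordinal ni)) /b_mx; case: (ltnP i.+1 n) => ni1.
    rewrite (a_mxE (Ordinal ni1)).
    exact: (@repr_gcomm _ _ _ (@Mrel_ab n (Ordinal ni) (Ordinal ni1) erefl)).
  rewrite a_mx_ge // -rho1; apply: repr_gcomm; apply: Mrel_anb; apply/eqP.
  by rewrite eqn_leq ni1 ni.
- exact: a_mx_ge.
Qed.

Lemma Mgroup_stable (W : {vspace 'cV[C]_m}) :
  (forall g v, v \in W -> rho g *m v \in W) <->
  (forall i w, w \in W -> a_mx i *m w \in W) /\ (forall w, w \in W -> b_mx *m w \in W).
Proof.
split=> [h|[hA hB]].
  split=> [i w wW|w wW]; last exact: h.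
  by rewrite /a_mx; case: insub => [j|]; rewrite ?mul1mx //; exact: h.
apply: repr_stable => -[i|] v vW; last exact: hB.
by rewrite -a_mxE hA.
Qed.

End Mtuples.

Section MreprGen.
Variables (R : realType) (n m : nat) (A : nat -> 'M[R[i]]_m) (B : 'M[R[i]]_m).
Hypothesis AB : Mtuple n A B.

Lemma a_mx_Mrepr i : a_mx (Mrepr AB) i = A i.
Proof.
case: (ltnP i n) => ni; last by have [_ _ _ _ h] := AB; rewrite a_mx_ge // h.
rewrite (a_mxE _ (Ordinal ni)).
exact: (presented_repr_gen (Mgen_mx_unit AB) (Mgen_mx_rel AB) (Some (Ordinal ni))).
Qed.

Lemma b_mx_Mrepr : b_mx (Mrepr AB) = B.
Proof. exact: (presented_repr_gen (Mgen_mx_unit AB) (Mgen_mx_rel AB) None). Qed.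

End MreprGen.

Lemma Mgroup_intertwine (R : realType) (n m : nat)
    (rho sigma : representation R (Mgroup n) m) (P : 'M[R[i]]_m) :
  (forall i, P *m a_mx rho i = a_mx sigma i *m P) ->
  P *m b_mx rho = b_mx sigma *m P ->
  forall g, P *m rho g = sigma g *m P.
Proof. by move=> hA hB; apply: repr_intertwine => -[i|] //; rewrite -!a_mxE. Qed.

Section Orbit.
Variables (R : realType) (n m : nat).
Local Notation C := R[i].
Variables (A : nat -> 'M[C]_m) (B : 'M[C]_m) (AB : Mtuple n A B).

Lemma eigenvalue_rank (v : 'cV[C]_m) (lam : nat -> C) : v != 0 ->
  (forall i, A i *m v = lam i *: v) -> char_of_rank n lam.
Proof.
move=> v0 vE; case: AB => Au _ _ _ A1; split=> i.
  apply/eqP => l0; case/eqP: v0.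
  by rewrite -[v](mulKmx (Au i)) vE l0 scale0r mulmx0.
move=> ni; have := vE i; rewrite A1 // mul1mx => /eqP.
rewrite -subr_eq0 -{1}[v]scale1r -scalerBl scaler_eq0 (negPf v0) orbF subr_eq0.
by move/eqP.
Qed.

(** From A_i B = B A_i A_(i+1), B carries the lam-eigenspace into the eigenspace of
    [char_shift lam]. *)
Lemma eigen_iter (v : 'cV[C]_m) (lam : nat -> C) k :
  (forall i, A i *m v = lam i *: v) ->
  forall i, A i *m iter k (mulmx B) v =
    iter k (@char_shift C) lam i *: iter k (mulmx B) v.
Proof.
move=> vE; case: AB => _ _ _ ABE _; elim: k => //= k IH i.
rewrite mulmxA ABE -!mulmxA !IH -!scalemxAr IH -scalemxAr scalerA.
by rewrite mulrC.
Qed.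

Lemma iter_mulmx_neq0 (v : 'cV[C]_m) k : v != 0 -> iter k (mulmx B) v != 0.
Proof.
case: AB => _ Bu _ _ _ v0; elim: k => //= k; apply: contraNneq => e.
by rewrite -[iter _ _ _](mulKmx Bu) e mulmx0.
Qed.

Hypothesis irr : forall W : {vspace 'cV[C]_m},
  (forall i w, w \in W -> A i *m w \in W) -> (forall w, w \in W -> B *m w \in W) ->
  W = 0%VS \/ W = fullv.

Lemma eigen_inj_leq k (v : 'cV[C]_m) (lam : nat -> C) : v != 0 ->
  (forall i, A i *m v = lam i *: v) ->
  injective (fun j : 'I_k => iter j (@char_shift C) lam) -> (k <= m)%N.
Proof.
move=> v0 vE lamI.
have := @eigen_row_free R m A k (fun j => iter j (mulmx B) v) _ _ lamI.
rewrite /row_free => /(_ _ _)/eqP rk.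
rewrite -[X in (X <= _)%N]rk; first exact: rank_leq_col.
  by move=> j i; exact: eigen_iter.
by move=> j; exact: iter_mulmx_neq0.
Qed.

(* If t is the period of [lam], then B^t maps the eigenspace of [lam] to itself, *)
(* hence has an eigenvector u there; u, Bu, ..., B^(t-1)u span a subrepresentation. *)
Lemma orbit_basis (v : 'cV[C]_m) (lam : nat -> C) : v != 0 ->
  (forall i, A i *m v = lam i *: v) ->
  [/\ iter m (@char_shift C) lam = lam,
      injective (fun j : 'I_m => iter j (@char_shift C) lam) &
      exists (u : 'cV[C]_m) (c : C), [/\ u != 0, c != 0,
        forall i, A i *m u = lam i *: u & iter m (mulmx B) u = c *: u]].
Proof.
move=> v0 vE; have lamR := eigenvalue_rank v0 vE.
have canc a b : (a <= b)%N -> iter a (@char_shift C) lam = iter b (@char_shift C) lam ->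
    iter (b - a) (@char_shift C) lam = lam.
  apply: (@iter_cancel _ (char_of_rank n)) => //; first exact: char_shift_rank.
  exact: char_shift_inj.
(* A period exists: otherwise the first m + 1 iterates of lam would be distinct, giving m + 1
   independent vectors in dimension m. *)
have exP : exists t, (0 < t)%N && `[< iter t (@char_shift C) lam = lam >].
  apply: contrapT => h; have := @eigen_inj_leq m.+1 v lam v0 vE.
  rewrite ltnn => H; suff: false by []. apply: H => j k e.
  apply/val_inj/eqP; rewrite eqn_leq; apply/andP;
    split; rewrite leqNgt; apply/negP => lt;
    apply: h; [exists (j - k)%N|exists (k - j)%N];
    by rewrite subn_gt0 lt; apply/asboolP/canc; rewrite // ltnW.
case: (ex_minnP exP) => t /andP[t0 /asboolP tE] tmin.
have tI : injective (fun j : 'I_t => iter j (@char_shift C) lam).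
  move=> j k e; apply/val_inj/eqP; rewrite eqn_leq; apply/andP.
  split; rewrite leqNgt; apply/negP => lt.
    have /tmin : (0 < j - k)%N && `[< iter (j - k) (@char_shift C) lam = lam >].
      by rewrite subn_gt0 lt; apply/asboolP/canc; rewrite // ltnW.
    by rewrite leqNgt (leq_ltn_trans (leq_subr _ _)).
  have /tmin : (0 < k - j)%N && `[< iter (k - j) (@char_shift C) lam = lam >].
    by rewrite subn_gt0 lt; apply/asboolP/canc; rewrite // ltnW.
  by rewrite leqNgt (leq_ltn_trans (leq_subr _ _)).
pose Bt : 'M[C]_m := iter t (mulmx B) 1%:M.
have BtE u : Bt *m u = iter t (mulmx B) u.
  rewrite /Bt; elim: t {t0 tE tmin tI Bt} => [|k IH] /=; first by rewrite mul1mx.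
  by rewrite -mulmxA IH.
have [|u [c [uE u0]]] := @eigenvector_in R m Bt
    (fun w => forall i, A i *m w = lam i *: w) v _ vE v0.
  move=> w c wE i; rewrite mulmxBr BtE (eigen_iter t wE) tE -scalemxAr wE scalerBr.
  by rewrite !scalerA mulrC.
rewrite BtE => uc.
have c0 : c != 0.
  by apply: contraTneq (iter_mulmx_neq0 t u0) => c0; rewrite uc c0 scale0r eqxx.
pose X := [seq iter k (mulmx B) u | k <- iota 0 t].
have XP k : (k < t)%N -> iter k (mulmx B) u \in <<X>>%VS.
  by move=> kt; apply/memv_span/map_f; rewrite mem_iota.
have [W0|WT] : <<X>>%VS = 0%VS \/ <<X>>%VS = fullv.
- apply: irr.
    move=> i; apply: stable_span => _ /mapP[k kt ->].
    by rewrite (eigen_iter k uE) memvZ // XP //; rewrite mem_iota in kt.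
  apply: stable_span => w /mapP[k]; rewrite mem_iota /= add0n => kt ->.
  rewrite -iterS; move: kt; rewrite leq_eqVlt => /orP[/eqP kt|]; last exact: XP.
  by rewrite kt uc memvZ // (XP 0%N).
- by have := XP 0%N t0; rewrite W0 memv0 (negPf u0).
(* The t independent eigenvectors give t <= m; the spanning family of size t gives m <= t. *)
have mt : m = t.
  apply/eqP; rewrite eqn_leq (eigen_inj_leq v0 vE tI) andbT.
  have := dim_span X; rewrite WT dimvf size_map size_iota.
  by rewrite /dim /= muln1.
by subst t; split=> //; exists u, c.
Qed.

End Orbit.

(** * Standard models of the irreducible representations *)

Section Model.
Variables (R : realType) (n m : nat).
Local Notation C := R[i].
Local Notation T := (@char_shift C).
Implicit Types lam mu : nat -> C.

(** On the basis e_0, ..., e_(m-1), the vector e_k has character T^k lam and b sends e_k to e_(k+1),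
    indices modulo m; thus b^m = 1. *)
Definition model_a lam i : 'M[C]_m := diag_mx (\row_(k < m) iter k T lam i).
Definition model_b : 'M[C]_m := \matrix_(j, k) (j == ordS k)%:R.

Lemma mul_model_b k (X : 'M[C]_(k, m)) : X *m model_b = \matrix_(i, j) X i (ordS j).
Proof.
apply/matrixP => i j; rewrite !mxE (bigD1 (ordS j)) //= big1 => [|l lj].
  by rewrite mxE eqxx mulr1 addr0.
by rewrite mxE (negPf lj) mulr0.
Qed.

Lemma iter_ordS (U : Type) (f : U -> U) (x : U) (j : 'I_m) :
  iter m f x = x -> iter (ordS j) f x = iter j.+1 f x.
Proof.
move=> fx; rewrite /=; case: (ltnP j.+1 m) => jm; first by rewrite modn_small.
have -> : j.+1 = m by apply/eqP; rewrite eqn_leq jm ltn_ord.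
by rewrite modnn -iterS; have -> : j.+1 = m by apply/eqP; rewrite eqn_leq jm ltn_ord.
Qed.

Variables (lam : nat -> C) (lamR : char_of_rank n lam) (lamT : iter m T lam = lam).

Lemma Mtuple_model : Mtuple n (model_a lam) model_b.
Proof.
have rk k := iter_char_shift_rank k lamR.
split=> [i||i j|i|i ni].
- rewrite unitmxE det_diag unitfE prodf_seq_neq0; apply/allP => k _ /=.
  by rewrite mxE; case: (rk k).
- suff /mulmx1_unit[] : model_b^T *m model_b = 1%:M by [].
  rewrite mul_model_b; apply/matrixP => i j; rewrite !mxE.
  by rewrite (inj_eq (can_inj (@ordSK _))) eq_sym.
- exact: diag_mxC.
- rewrite mul_model_b; apply/matrixP => j k.
  rewrite -mulmxA mulmx_diag mul_mx_diag !mxE.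
  case: eqP => [->|_]; last by rewrite mulr0n mul0r.
  by rewrite iter_ordS //= mulr1n mul1r.
- apply/matrixP => j k; rewrite !mxE; case: eqP => // _.
  by case: (rk j) => _ ->.
Qed.

Definition model : representation R (Mgroup n) m := Mrepr Mtuple_model.

Lemma a_mx_model i : a_mx model i = model_a lam i. Proof. exact: a_mx_Mrepr. Qed.
Lemma b_mx_model : b_mx model = model_b. Proof. exact: b_mx_Mrepr. Qed.

(** The vectors u, bu, ..., b^(m-1)u carry distinct characters, hence form a basis, in which rho has
    the matrices of the model; b^m u = u closes the cycle. *)
Lemma model_iso (rho : representation R (Mgroup n) m) (u : 'cV[C]_m) :
  injective (fun j : 'I_m => iter j T lam) -> u != 0 ->
  (forall i, a_mx rho i *m u = lam i *: u) -> iter m (mulmx (b_mx rho)) u = u ->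
  iso_repr rho model.
Proof.
move=> lamI u0 uE ub; have AB := Mtuple_repr rho.
pose P : 'M[C]_m := fam_mx (fun j => iter j (mulmx (b_mx rho)) u).
have Pu : P \in unitmx.
  rewrite -unitmx_tr -row_free_unit.
  apply: (@eigen_row_free R m (a_mx rho) m _ (fun j => iter j T lam)) => //.
    by move=> j; exact: (eigen_iter AB).
  by move=> j; exact: (iter_mulmx_neq0 AB).
exists (invmx P) => [|g]; first by rewrite unitmx_inv.
apply: (can_inj (mulKmx Pu)); rewrite mulKVmx // mulmxA.
apply: (can_inj (mulmxK Pu)); rewrite -[RHS]mulmxA mulVmx // mulmx1.
apply/esym; move: g; apply: Mgroup_intertwine => [i|].
  rewrite a_mx_model mul_mx_diag mul_fam_mx; apply/matrixP => j k.
  by rewrite [RHS]mxE (eigen_iter AB k uE) !mxE mulrC.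
rewrite b_mx_model mul_model_b mul_fam_mx; apply/matrixP => j k.
by rewrite [LHS]mxE [RHS]mxE mxE iter_ordS.
Qed.

Hypothesis lamI : injective (fun j : 'I_m => iter j T lam).

(** A nonzero vector of a stable W has a nonzero component, whose basis vector lies in W by
    [eigen_separation]; b then moves it to every other basis vector. *)
Lemma model_irreducible : (0 < m)%N -> irreducible_repr model.
Proof.
move=> m0; split=> // W /Mgroup_stable[WA WB].
case: (eqVneq W 0%VS) => [|W0]; [by left|right].
have [w wW w0] : exists2 w, w \in W & w != 0.
  by exists (vpick W); [exact: memv_pick|rewrite vpick0].
have [k wk] : exists k, w k 0 != 0.
  apply: contrapT => h; case/eqP: w0; apply/colP => k; rewrite mxE.
  by apply/eqP/negPn/negP => wk; apply: h; exists k.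
have ek : delta_mx k 0 \in W.
  have : w k 0 *: delta_mx k 0 \in W.
    apply: (@eigen_separation R m (a_mx model) W m (fun j => w j 0 *: delta_mx j 0)
      (fun j => iter j T lam)) => // [j i|].
      rewrite a_mx_model -scalemxAr scalerA [_ * w _ _]mulrC -scalerA; congr (_ *: _).
      apply/matrixP => r s; rewrite mul_diag_mx !mxE.
      by case: eqP => [->|]; rewrite ?mulr0.
    by move: wW; rewrite {1}[w]matrix_sum_delta; under eq_bigr do rewrite big_ord1.
  by move/(memvZ (w k 0)^-1); rewrite scalerA mulVf // scale1r.
have eiter j : delta_mx (iter j (@ordS m) k) 0 \in W.
  elim: j => //= j /WB; rewrite b_mx_model; congr (_ \in W).
  apply/matrixP => r s; rewrite !mxE (bigD1 (iter j (@ordS m) k)) //= big1 => [|l lj].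
    by rewrite !mxE !eqxx /= ord1 eqxx andbT mulr1 addr0.
  by rewrite !mxE (negPf lj) /= mulr0.
have iterE j : (iter j (@ordS m) k = (k + j) %% m :> nat)%N.
  elim: j => [|j IH] /=; first by rewrite addn0 modn_small.
  by rewrite IH -addn1 modnDml addn1 addnS.
have eall j : delta_mx j 0 \in W.
  have -> : j = iter (j + (m - k)) (@ordS m) k; last exact: eiter.
  apply/val_inj; rewrite /= iterE addnCA subnKC ?modnDr ?modn_small //.
  exact: ltnW.
apply/eqP; rewrite eqEsubv subvf /=; apply/subvP => x _.
rewrite [x]matrix_sum_delta; apply: memv_suml => j _.
by rewrite big_ord1 memvZ.
Qed.

End Model.

(** * Twist classes as orbits of tails *)

(** The coordinate 0 never feeds into another one, so rescaling it commutes with T. *)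
Lemma iter_char_shift_scale (F : fieldType) (s lam : nat -> F) k :
  (forall i, s i.+1 = 1) ->
  iter k (@char_shift F) (fun i => s i * lam i) =
  fun i => s i * iter k (@char_shift F) lam i.
Proof.
move=> s1; elim: k => //= k ->; apply/funext => i.
by rewrite /char_shift s1 mul1r mulrA.
Qed.

Lemma iter_char_shift_tail (F : fieldType) (lam : nat -> F) k :
  iter k (@char_shift F) (fun i => lam i.+1) = fun i => iter k (@char_shift F) lam i.+1.
Proof. by elim: k => //= k ->. Qed.

Lemma iter_scalemx (F : fieldType) m (B : 'M[F]_m) (y : F) (u : 'cV[F]_m) k :
  iter k (mulmx (y *: B)) u = y ^+ k *: iter k (mulmx B) u.
Proof.
elim: k => [|k IH] /=; first by rewrite scale1r.
by rewrite IH -scalemxAl -scalemxAr scalerA -exprS.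
Qed.

Section Classification.
Variables (R : realType) (n m : nat).
Local Notation C := R[i].
Local Notation T := (@char_shift C).
Implicit Types lam mu : nat -> C.
Implicit Types rho : representation R (Mgroup n) m.

Lemma Mgroup_linear_char (x y : C) : (0 < n)%N -> x != 0 -> y != 0 ->
  exists chi : representation R (Mgroup n) 1,
    (forall i, a_mx chi i = (if i == 0 then x else 1)%:M) /\ b_mx chi = y%:M.
Proof.
move=> n0 x0 y0.
have AB : Mtuple n (fun i : nat => (if i == 0 then x else 1)%:M : 'M[C]_1) y%:M.
  split=> [i||i j|i|i ni].
  - by rewrite unitmxE det_scalar1 unitfE; case: ifP => _ //; exact: oner_neq0.
  - by rewrite unitmxE det_scalar1 unitfE.
  - exact: scalar_mxC.
  - by rewrite /= mulmx1 scalar_mxC.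
  - by rewrite gtn_eqF // (leq_trans n0).
by exists (Mrepr AB); split=> [i|]; rewrite ?a_mx_Mrepr ?b_mx_Mrepr.
Qed.

Lemma a_mx_twist (chi : representation R (Mgroup n) 1) rho i :
  a_mx (twist chi rho) i = a_mx chi i 0 0 *: a_mx rho i.
Proof.
by rewrite /a_mx; case: insub => [j|] //; rewrite mxE eqxx scale1r.
Qed.

Lemma b_mx_twist (chi : representation R (Mgroup n) 1) rho :
  b_mx (twist chi rho) = b_mx chi 0 0 *: b_mx rho.
Proof. by []. Qed.

Lemma irreducible_a_b rho : irreducible_repr rho -> forall W : {vspace 'cV[C]_m},
  (forall i w, w \in W -> a_mx rho i *m w \in W) ->
  (forall w, w \in W -> b_mx rho *m w \in W) -> W = 0%VS \/ W = fullv.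
Proof. by case=> m0 irr W WA WB; apply: irr; apply/Mgroup_stable. Qed.

Lemma irreducible_eigenvector rho : irreducible_repr rho ->
  exists (v : 'cV[C]_m) lam, v != 0 /\ forall i, a_mx rho i *m v = lam i *: v.
Proof.
case=> m0 _; have [_ _ AA _ _] := Mtuple_repr rho.
have [v [lam [v0 vE]]] := common_eigenvector_nat n m0 AA.
exists v, (fun i => if (i < n)%N then lam i else 1); split=> // i.
by case: ltnP => ni; [exact: vE|rewrite a_mx_ge // mul1mx scale1r].
Qed.

(** A twist alters the eigenvalue of a_1 and the scalar b^m at will, so only the tail of lam
    matters. *)
Lemma twist_equiv_model rho (v : 'cV[C]_m) lam mu
    (muR : char_of_rank n mu) (muT : iter m T mu = mu) :
  (0 < n)%N -> irreducible_repr rho -> v != 0 ->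
  (forall i, a_mx rho i *m v = lam i *: v) -> (forall i, mu i.+1 = lam i.+1) ->
  twist_equiv rho (model muR muT).
Proof.
move=> n0 irr v0 vE mulam; have [m0 _] := irr.
have AB := Mtuple_repr rho; have irrW := irreducible_a_b irr.
have [l0 _] := eigenvalue_rank AB v0 vE.
have [lamT lamI [u [c [u0 c0 uE uc]]]] := orbit_basis AB irrW v0 vE.
(* The twist by y on b turns b^m u = c u into (y b)^m u = u. *)
pose y := m.-root c^-1; have yE : y ^+ m = c^-1 by rewrite rootCK.
have y0 : y != 0 by rewrite rootC_eq0 // invr_eq0.
have x0 : mu 0%N / lam 0%N != 0 by case: muR => m00 _; rewrite mulf_neq0 // invr_eq0.
have [chi [chia chib]] := Mgroup_linear_char n0 x0 y0.
pose s (i : nat) : C := if i == 0 then mu 0%N / lam 0%N else 1.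
have muE : mu = fun i => s i * lam i.
  apply/funext => -[|i]; rewrite /s /=; first by rewrite divfK.
  by rewrite mul1r mulam.
exists chi; apply: (model_iso muR muT (u := u)) => //.
- move=> j k; rewrite muE !iter_char_shift_scale // => e; apply: lamI.
  apply/funext => i; have := congr1 (@^~ i) e; apply: mulfI.
  by rewrite /s; case: ifP => // _; exact: oner_neq0.
- move=> i; rewrite a_mx_twist chia mxE eqxx mulr1n -scalemxAl uE scalerA.
  by rewrite (congr1 (@^~ i) muE).
rewrite b_mx_twist chib mxE eqxx mulr1n iter_scalemx uc scalerA yE mulVf //.
by rewrite scale1r.
Qed.

Lemma model_twist_inv lam mu (lamR : char_of_rank n lam) (lamT : iter m T lam = lam)
    (muR : char_of_rank n mu) (muT : iter m T mu = mu) :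
  (0 < m)%N -> twist_equiv (model lamR lamT) (model muR muT) ->
  exists k, forall i, mu i.+1 = iter k T lam i.+1.
Proof.
move=> m0 [chi [P Pu PE]].
(* A nonzero entry of P in row 0 and column k forces the characters of e_k and e_0 to agree up to
   the twist. *)
have [k Pk] : exists k, P (Ordinal m0) k != 0.
  apply: contrapT => h; have : row (Ordinal m0) P = 0.
    apply/rowP => k; rewrite !mxE; apply/eqP/negPn/negP => Pk; apply: h; by exists k.
  move/(congr1 (mulmx^~ (invmx P))); rewrite -row_mul mulmxV // mul0mx.
  by move/rowP/(_ (Ordinal m0))/eqP; rewrite !mxE eqxx oner_eq0.
have PA i : P *m a_mx (twist chi (model lamR lamT)) i = a_mx (model muR muT) i *m P.
  case: (ltnP i n) => ni; first by rewrite !(a_mxE _ (Ordinal ni)) PE.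
  by rewrite !a_mx_ge // mul1mx mulmx1.
exists k => i; have [_ ub _ AB _] := Mtuple_repr chi.
(* a_(i+1) is a commutator, so a one-dimensional representation sends it to 1. *)
have chi1 : a_mx chi i.+1 = 1%:M.
  have [ua _ _ _ _] := Mtuple_repr chi.
  have := AB i; rewrite -[b_mx chi *m _ *m _]mulmxA => e.
  have : a_mx chi i *m a_mx chi i.+1 = a_mx chi i.
    apply: (can_inj (mulKmx ub)); rewrite -e.
    rewrite [a_mx chi i]mx11_scalar [b_mx chi]mx11_scalar; exact: scalar_mxC.
  by move/(congr1 (mulmx (invmx (a_mx chi i)))); rewrite mulKmx // mulVmx.
have := PA i.+1; rewrite a_mx_twist !a_mx_model chi1 mxE eqxx scale1r.
rewrite mul_mx_diag mul_diag_mx => /matrixP/(_ (Ordinal m0) k).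
by rewrite !mxE /= mulrC => /(mulIf Pk).
Qed.

End Classification.

(** * Counting orbits *)

(** A coincidence of two iterates gives a period d with 0 < d < p^N; then gcd(d, p^N) is a period
    too, and it is a power p^k with k < N. *)
Lemma iter_pfactor_inj (T : Type) (P : T -> Prop) (f : T -> T) (x : T) (p N : nat) :
  (forall y, P y -> P (f y)) ->
  (forall y z, P y -> P z -> f y = f z -> y = z) ->
  P x -> prime p -> iter (p ^ N) f x = x ->
  (forall k, (k < N)%N -> iter (p ^ k) f x <> x) ->
  injective (fun j : 'I_(p ^ N) => iter j f x).
Proof.
move=> Pf finj Px pp fx fk.
suff le (a b : 'I_(p ^ N)) : iter a f x = iter b f x -> (a <= b)%N.
  move=> a b e; apply/val_inj/eqP; rewrite eqn_leq (le a b e).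
  by rewrite (le b a (esym e)).
move=> e; rewrite leqNgt; apply/negP => ba.
have d : iter (a - b) f x = x.
  by apply: (iter_cancel Pf finj Px (ltnW ba)).
have [k kN kE] : exists2 k, (k <= N)%N & gcdn (a - b) (p ^ N) = (p ^ k)%N.
  by apply/(dvdn_pfactor _ _ pp); exact: dvdn_gcdr.
have := iter_gcdn d fx; rewrite kE; move: kN.
rewrite leq_eqVlt => /orP[/eqP ?|]; last exact: fk.
subst k; have : (gcdn (a - b) (p ^ N) <= a - b)%N.
  by rewrite dvdn_leq ?dvdn_gcdl ?subn_gt0.
by rewrite kE leqNgt (leq_ltn_trans (leq_subr _ _)).
Qed.

Lemma order_uniq_traject (T : finType) (f : T -> T) (x : T) (d : nat) : (0 < d)%N ->
  iter d f x = x -> injective (fun j : 'I_d => iter j f x) -> order f x = d.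
Proof.
case: d => // d _ fx inj.
rewrite (@order_cycle _ _ (traject f x d.+1)) ?size_traject //.
- by rewrite trajectS /= -[X in rcons _ X]fx iterSr -trajectSr fpath_traject.
- apply/(uniqP x) => i j; rewrite !inE size_traject => il jl.
  rewrite !nth_traject // => e.
  by have := inj (Ordinal il) (Ordinal jl) e; case.
- by rewrite trajectS mem_head.
Qed.

Lemma closed_prim_root_exists (F : numClosedFieldType) n : (0 < n)%N ->
  exists z : F, n.-primitive_root z.
Proof.
move=> n0; pose P : {poly F} := 'X^n - 1; have [r Dp] := closed_field_poly_normal P.
rewrite (monicP _) ?monicXnsubC // scale1r in Dp.
have rn1 : all n.-unity_root r by apply/allP => z; rewrite -root_prod_XsubC -Dp.
have sz_r : (n < (size r).+1)%N by rewrite -(size_prod_XsubC r id) -Dp size_XnsubC.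
have [|z] := hasP (has_prim_root n0 rn1 _ sz_r); last by exists z.
by rewrite -separable_prod_XsubC -Dp separable_Xn_sub_1 // pnatr_eq0 -lt0n.
Qed.

(** Extends a tail to a full character with first coordinate 1, a choice that is harmless up to
    twist. *)
Definition char_cons (F : fieldType) (mu : nat -> F) : nat -> F :=
  fun i => if i is j.+1 then mu j else 1.

Lemma char_cons_rank (F : fieldType) n (mu : nat -> F) :
  char_of_rank n mu -> char_of_rank n.+1 (char_cons mu).
Proof. by case=> m0 m1; split=> -[|i] //=; [exact: oner_neq0|exact: m1]. Qed.

(** * Tails as vectors over Z/p^N *)

Section Exponents.
Variables (F : fieldType) (s p N : nat) (hp : prime p) (hsp : (s.+2 <= p)%N).
Variables (z : F) (hz : (p ^ N).-primitive_root z).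
Local Notation T := (@char_shift F).
Local Notation X := {ffun 'I_s.+1 -> 'I_(p ^ N)}.
Implicit Types x y : X.

Lemma pN_gt0 : (0 < p ^ N)%N. Proof. by rewrite expn_gt0 prime_gt0. Qed.

(* [x] encodes the tail (lam_2, ..., lam_n), n = s + 2, with lam_(i+2) = z^(x_i). *)
Definition exponent x (i : nat) : nat := if insub i is Some j then val (x j) else 0.

Lemma exponentE x (i : 'I_s.+1) : exponent x i = x i. Proof. by rewrite /exponent valK. Qed.
Lemma exponent_ge x i : (s.+1 <= i)%N -> exponent x i = 0.
Proof. by move=> h; rewrite /exponent insubF // ltnNge h. Qed.

Definition exp_shift x : X :=
  [ffun j : 'I_s.+1 => Ordinal (ltn_pmod (exponent x j + exponent x j.+1) pN_gt0)].

Definition exp_char x : nat -> F := fun i => z ^+ exponent x i.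

Lemma exp_char_rank x : char_of_rank s.+1 (exp_char x).
Proof.
split=> i; last by move=> h; rewrite /exp_char exponent_ge // expr0.
rewrite expf_neq0 //; apply/eqP => z0; have := prim_expr_order hz.
by move/eqP; rewrite z0 expr0n gtn_eqF ?pN_gt0 // eq_sym oner_eq0.
Qed.

Lemma exp_char_inj : injective exp_char.
Proof.
move=> x y e; apply/ffunP => j; apply/val_inj/eqP.
have /eqP := congr1 (@^~ (j : nat)) e.
by rewrite /exp_char !exponentE (eq_prim_root_expr hz) !modn_small.
Qed.

Lemma exp_char_shift x : exp_char (exp_shift x) = T (exp_char x).
Proof.
apply/funext => i; rewrite /char_shift /exp_char -exprD.
case: (ltnP i s.+1) => h; last by rewrite !exponent_ge // ltnW.
by rewrite -(prim_expr_mod hz (_ + _)) (exponentE _ (Ordinal h)) ffunE.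
Qed.

Lemma exp_char_iter k x : exp_char (iter k exp_shift x) = iter k T (exp_char x).
Proof. by elim: k => //= k IH; rewrite exp_char_shift IH. Qed.

Lemma exp_shift_inj : injective exp_shift.
Proof.
move=> x y /(congr1 exp_char); rewrite !exp_char_shift => e.
by apply/exp_char_inj/(char_shift_inj (exp_char_rank x) (exp_char_rank y)).
Qed.

Lemma exp_char_pfactor x i k : (k <= N)%N ->
  (exp_char x i ^+ (p ^ k) == 1) = (p ^ (N - k) %| exponent x i)%N.
Proof.
move=> kN; rewrite /exp_char -exprM -(prim_order_dvd hz).
by rewrite -{1}(subnK kN) expnD dvdn_pmul2r // expn_gt0 prime_gt0.
Qed.

Lemma exp_char_pN x i : exp_char x i ^+ (p ^ N) = 1.
Proof. by apply/eqP; rewrite exp_char_pfactor // subnn dvd1n. Qed.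

(* The p^k-torsion of Z/p^N consists of the multiples of p^(N-k); when k > N the *)
(* truncated subtraction makes the condition void, as it should.                 *)
Definition all_tors k x := [forall j : 'I_s.+1, (p ^ (N - k) %| x j)%N].
Definition tail_tors k x := [forall j : 'I_s.+1, (0 < j)%N ==> (p ^ (N - k) %| x j)%N].

(** [char_shift_pfactorP] at rank n = s + 2: the period concerns the full character, so every
    coordinate of the tail is constrained. *)
Lemma all_torsP k x : (k <= N)%N ->
  reflect (iter (p ^ k) T (char_cons (exp_char x)) = char_cons (exp_char x))
    (all_tors k x).
Proof.
move=> kN; apply: (iffP forallP) => [h|/(char_shift_pfactorP k hp hsp) h j].
  apply/(char_shift_pfactorP k hp hsp) => [|i /=].
    exact/char_cons_rank/exp_char_rank.
  apply/eqP; rewrite exp_char_pfactor //.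
  by case: (ltnP i s.+1) => il; [rewrite (exponentE _ (Ordinal il))|rewrite exponent_ge].
rewrite -exponentE -exp_char_pfactor //; apply/eqP.
exact: (h (char_cons_rank (exp_char_rank x)) j).
Qed.

(** The same criterion at rank s + 1, for the tail itself: its first coordinate is now
    unconstrained. *)
Lemma tail_torsP k x : (k <= N)%N -> reflect (iter (p ^ k) exp_shift x = x) (tail_tors k x).
Proof.
move=> kN; have rk := exp_char_rank x.
have PP := @char_shift_pfactorP _ s.+1 p k (exp_char x) hp (ltnW hsp) rk.
apply: (iffP forallP) => [h|fx j].
  apply: exp_char_inj; rewrite exp_char_iter; apply/PP => i.
  apply/eqP; rewrite exp_char_pfactor //.
  case: (ltnP i.+1 s.+1) => il; last by rewrite exponent_ge.
  by rewrite (exponentE _ (Ordinal il)); exact: (implyP (h (Ordinal il))).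
apply/implyP => j0; rewrite -exponentE -exp_char_pfactor // -(prednK j0).
by apply/eqP; apply: (proj1 PP); rewrite -exp_char_iter fx.
Qed.

(* The tail of [char_shift lam] is the shifted tail, and [char_shift] is injective. *)
Lemma all_tors_shift k x : (k <= N)%N -> all_tors k (exp_shift x) = all_tors k x.
Proof.
move=> kN; set lam := char_cons (exp_char x).
have lR : char_of_rank s.+2 lam by exact/char_cons_rank/exp_char_rank.
have PT := @char_shift_pfactorP _ s.+2 p k (T lam) hp hsp (char_shift_rank lR).
have PS := @char_shift_pfactorP _ s.+2 p k _ hp hsp
  (char_cons_rank (exp_char_rank (exp_shift x))).
apply/(all_torsP _ kN)/(all_torsP _ kN); rewrite -/lam.
  move/PS; rewrite /= exp_char_shift => h.
  have : iter (p ^ k) T (T lam) = T lam by apply/PT => i; exact: h.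
  rewrite -iterSr iterS; exact: (char_shift_inj (iter_char_shift_rank (p ^ k) lR) lR).
move=> e; apply/PS => i /=; rewrite exp_char_shift.
have : iter (p ^ k) T (T lam) = T lam by rewrite -iterSr iterS e.
by move/PT/(_ i).
Qed.

Lemma tail_tors_shift k x : (k <= N)%N -> tail_tors k (exp_shift x) = tail_tors k x.
Proof.
move=> kN; apply/(tail_torsP _ kN)/(tail_torsP _ kN); rewrite -iterSr iterS.
  exact: exp_shift_inj.
by move=> ->.
Qed.

Lemma tors_dvdn k l a : (k <= l)%N -> (p ^ (N - k) %| a -> p ^ (N - l) %| a)%N.
Proof. by move=> kl; apply: dvdn_trans; rewrite dvdn_exp2l // leq_sub2l. Qed.

Lemma all_tors_mono k l x : (k <= l)%N -> all_tors k x -> all_tors l x.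
Proof. by move=> kl /forallP h; apply/forallP => j; exact: tors_dvdn (h j). Qed.

Lemma tail_tors_mono k l x : (k <= l)%N -> tail_tors k x -> tail_tors l x.
Proof.
move=> kl /forallP h; apply/forallP => j; apply/implyP => j0.
exact: tors_dvdn (implyP (h j) j0).
Qed.

End Exponents.

(** The coefficients of (1 - x)/(1 - a x). For a = p^d they count the vectors of (Z/p^k)^d of
    exponent exactly p^k. *)
Definition pow_diff (a k : nat) : nat := if k is j.+1 then (a ^ j.+1 - a ^ j)%N else 1.

(** * Counting vectors and orbits of given exponents *)

Section Counting.
Variables (F : fieldType) (s p N : nat) (hp : prime p) (hsp : (s.+2 <= p)%N).
Variables (z : F) (hz : (p ^ N).-primitive_root z).
Local Notation X := {ffun 'I_s.+1 -> 'I_(p ^ N)}.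
Local Notation f := (@exp_shift s p N hp).
Implicit Types x y : X.

(* The two conditions say that the whole tail has exponent exactly p^N, and that *)
(* its coordinates other than the first have exponent exactly p^k.               *)
Definition full_order x := (N == 0)%N || ~~ all_tors N.-1 x.
Definition tail_order k x := tail_tors k x && ((k == 0)%N || ~~ tail_tors k.-1 x).

Lemma full_orderP x : reflect (forall k, (k < N)%N -> ~~ all_tors k x) (full_order x).
Proof.
apply: (iffP orP) => [[/eqP N0 k kN|h k kN]|h].
- by case/negP: (negbT (ltn0 k)); rewrite -[X in (_ < X)%N]N0.
- by apply: contra h; apply: all_tors_mono; rewrite -ltnS (ltn_predK kN).
- case: (posnP N) => N0; [by left; apply/eqP|right; apply: h].
  by rewrite prednK.
Qed.

Lemma tail_orderP k x :
  reflect (tail_tors k x /\ forall l, (l < k)%N -> ~~ tail_tors l x)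
    (tail_order k x).
Proof.
apply: (iffP andP) => -[t h]; split=> //.
  case/orP: h => [/eqP -> //|h l lk]; apply: contra h; apply: tail_tors_mono.
  by case: k {t} lk.
by case: k t h => //= k t h; apply: h.
Qed.

Lemma exists_tail_order x : exists k : 'I_N.+1, tail_order k x.
Proof.
have exP : exists k, tail_tors k x.
  exists N; apply/forallP => j; apply/implyP => _; by rewrite subnn dvd1n.
case: (ex_minnP exP) => k tk kmin.
have kN : (k < N.+1)%N.
  by apply: kmin; apply/forallP => j; apply/implyP => _; rewrite subnn dvd1n.
exists (Ordinal kN); apply/tail_orderP; split=> // l lk.
by apply/negP => /kmin; rewrite leqNgt lk.
Qed.

Lemma tail_order_uniq k l x : tail_order k x -> tail_order l x -> k = l.
Proof.
move=> /tail_orderP[tk mk] /tail_orderP[tl ml]; apply/eqP; rewrite eqn_leq.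
by apply/andP; split; rewrite leqNgt; apply/negP; [move/mk|move/ml]; rewrite ?tk ?tl.
Qed.

Lemma order_tail_order k x : (k <= N)%N -> tail_order k x -> order f x = (p ^ k)%N.
Proof.
move=> kN /tail_orderP[tk mk]; apply: order_uniq_traject.
- by rewrite expn_gt0 prime_gt0.
- exact/(tail_torsP hp hsp hz).
apply: (@iter_pfactor_inj _ (fun=> True)) => //.
- by move=> y1 y2 _ _; exact: (exp_shift_inj hz).
- exact/(tail_torsP hp hsp hz).
move=> l lk; apply/(tail_torsP hp hsp hz); first exact: (ltnW (leq_trans lk kN)).
exact: mk.
Qed.

Lemma full_order_shift x : full_order (f x) = full_order x.
Proof. by rewrite /full_order (all_tors_shift hp hsp hz) // leq_pred. Qed.

Lemma tail_order_shift k x : (k <= N)%N -> tail_order k (f x) = tail_order k x.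
Proof.
by move=> kN; rewrite /tail_order !(tail_tors_shift hp hsp hz) // (leq_trans (leq_pred _)).
Qed.

Definition tors k : {set 'I_(p ^ N)} := [set a : 'I_(p ^ N) | (p ^ (N - k) %| a)%N].

Lemma card_tors k : (k <= N)%N -> #|tors k| = (p ^ k)%N.
Proof.
move=> kN; have p0 j : (0 < p ^ j)%N by rewrite expn_gt0 prime_gt0.
have lt (a : 'I_(p ^ k)) : (a * p ^ (N - k) < p ^ N)%N.
  by rewrite -{2}(subnKC kN) expnD ltn_pmul2r.
rewrite -[RHS]card_ord -(card_imset _ (f := fun a : 'I_(p ^ k) => Ordinal (lt a))).
  apply: eq_card => b; rewrite inE; apply/idP/imsetP => [/dvdnP[c bc]|[a _ ->]]; last first.
    by rewrite /= dvdn_mull.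
  have cl : (c < p ^ k)%N.
    by rewrite -(ltn_pmul2r (p0 (N - k)%N)) -bc -expnD subnKC.
  by exists (Ordinal cl) => //; apply: val_inj.
move=> a b [] /eqP; rewrite eqn_pmul2r // => /eqP; exact: val_inj.
Qed.

Definition box (D : {set 'I_(p ^ N)}) k : {set X} :=
  [set x : X | (x ord0 \in D) && tail_tors k x].

Lemma card_box D k : (k <= N)%N -> #|box D k| = (#|D| * (p ^ s) ^ k)%N.
Proof.
move=> kN; pose G (j : 'I_s.+1) : pred 'I_(p ^ N) :=
  if j == ord0 then [pred a in D] else [pred a in tors k].
rewrite (eq_card (B := family G)) => [|x].
  rewrite card_family /image_mem enum_ordSl /= -map_comp.
  rewrite (eq_card (B := D)) => [|a]; last by rewrite !inE.
  congr (_ * _)%N; rewrite expnAC -[in RHS](size_enum_ord s).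
  elim: (enum 'I_s) => //= j e ->; rewrite expnS; congr (_ * _)%N.
  by rewrite -(card_tors kN); apply: eq_card => a; rewrite !inE.
rewrite inE; apply/andP/familyP => [[xD /forallP h] j|h].
  rewrite /G; case: (eqVneq j ord0) => [->|j0]; first by rewrite inE.
  rewrite !inE; apply: (implyP (h j)); by rewrite lt0n.
split; first by have := h ord0; rewrite /G eqxx inE.
apply/forallP => j; apply/implyP => j0; have := h j.
by rewrite /G -val_eqE /= gtn_eqF // !inE.
Qed.

Lemma box_mono D k l : (k <= l)%N -> box D k \subset box D l.
Proof.
move=> kl; apply/fintype.subsetP => x; rewrite !inE => /andP[-> /=]; exact: tail_tors_mono.
Qed.

(** The first coordinates that complete the others, of exponent p^k, to a vector of exponent p^N:
    all of them if k = N, and only those of order p^N if k < N. *)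
Definition first_coord k : {set 'I_(p ^ N)} :=
  [set a | (k == N)%N || (a \notin tors N.-1)].

Lemma card_first_coord k : (k <= N)%N ->
  #|first_coord k| = (p ^ k * pow_diff p (N - k))%N.
Proof.
case: (eqVneq k N) => [-> _|kN kle].
  rewrite subnn muln1 -[RHS]card_ord; apply: eq_card => a.
  by rewrite !inE eqxx.
have kl : (k < N)%N by rewrite ltn_neqAle kN.
rewrite (_ : first_coord k = ~: tors N.-1)%SET; last first.
  by apply/setP => a; rewrite !inE (negPf kN).
rewrite cardsCs finset.setCK card_ord card_tors ?leq_pred //.
have -> : (N - k)%N = (N.-1 - k).+1 by lia.
by rewrite /= mulnBr -!expnD; congr (p ^ _ - p ^ _)%N; lia.
Qed.

Lemma all_tors_tail k x : all_tors k x = (x ord0 \in tors k) && tail_tors k x.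
Proof.
apply/forallP/andP => [h|[h0 /forallP h] j].
  by split; [rewrite inE h|apply/forallP => j; rewrite h implybT].
case: (posnP j) => [j0|]; last exact: implyP.
have -> : j = ord0 by exact: val_inj.
by rewrite inE in h0.
Qed.

Lemma full_order_first_coord k x : (k <= N)%N -> tail_order k x ->
  full_order x = (x ord0 \in first_coord k).
Proof.
move=> kN /tail_orderP[tk mk]; case: (eqVneq k N) => [kN'|kN'].
  rewrite inE kN' eqxx; apply/full_orderP => l lN.
  rewrite all_tors_tail negb_and mk ?orbT //.
  by rewrite kN'.
have kl : (k < N)%N by rewrite ltn_neqAle kN'.
rewrite /full_order gtn_eqF ?(leq_ltn_trans _ kl) // all_tors_tail inE.
by rewrite !inE (negPf kN') (tail_tors_mono (l := N.-1) _ tk) ?andbT //; lia.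
Qed.

Lemma card_full_tail_order k : (k <= N)%N ->
  #|[set x : X | full_order x && tail_order k x]%SET| =
  (p ^ k * (pow_diff (p ^ s) k * pow_diff p (N - k)))%N.
Proof.
move=> kN; rewrite mulnCA [RHS]mulnC -card_first_coord //; set D := first_coord k.
(* Exponent exactly p^k means p^k-torsion without the p^(k-1)-torsion; nothing is removed when k =
   0. *)
pose E : {set X} := if k is j.+1 then box D j else finset.set0.
have -> : [set x : X | full_order x && tail_order k x]%SET = box D k :\: E.
  apply/setP => x; rewrite finset.in_setD.
  have -> : (x \in E) = [&& k != 0, x ord0 \in D & tail_tors k.-1 x].
    by rewrite /E; case: k @D @E {kN} => [|k] D E; rewrite ?inE.
  have foE : tail_order k x -> full_order x = (x ord0 \in D).
    exact: (full_order_first_coord kN).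
  rewrite [LHS]inE [x \in box D k]inE; move: foE; rewrite /tail_order.
  case: (tail_tors k x); rewrite ?andbF //= !andbT.
  by case: (k == 0); case: (tail_tors k.-1 x); rewrite /= ?andbT ?andbF => h;
    rewrite ?h //; case: (x ord0 \in D).
rewrite cardsD /E; case: k @D @E kN => [|k] D E kN.
  by rewrite finset.setI0 cards0 subn0 card_box // expn0.
rewrite (finset.setIidPr (box_mono D (leqnSn k))) !card_box ?(ltnW kN) //.
by rewrite mulnBr.
Qed.

(** The vectors with given k form a union of orbits of length p^k, so their number is divided by
    p^k. The condition [froot f x == x] selects one vector per orbit. *)
Lemma card_orbit_reps :
  #|[set x : X | full_order x & froot f x == x]%SET| =
    (\sum_(k < N.+1) pow_diff (p ^ s) k * pow_diff p (N - k))%N.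
Proof.
have finj := @exp_shift_inj F s p N hp z hz.
pose dp x := xchoose (exists_tail_order x).
have dpE x (k : 'I_N.+1) : (dp x == k) = tail_order k x.
  apply/eqP/idP => [<-|dk]; first exact: (xchooseP (exists_tail_order x)).
  apply/val_inj/(tail_order_uniq (x := x)) => //; exact: (xchooseP (exists_tail_order x)).
rewrite -sum1_card (partition_big dp predT) //=; apply: eq_bigr => k _.
have kN : (k <= N)%N by rewrite -ltnS.
pose Y := [set x : X | full_order x && tail_order k x]%SET.
have Yo : Y \subset order_set f (p ^ k)%N.
  apply/fintype.subsetP => x; rewrite !inE => /andP[_ dx].
  by rewrite (order_tail_order kN dx).
have Yc : fclosed f Y.
  by move=> x y /eqP <-; rewrite !inE full_order_shift tail_order_shift.
have /eqP := fcard_order_set finj Yo Yc.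
rewrite card_full_tail_order // [(p ^ k * _)%N]mulnC.
rewrite eqn_pmul2r ?expn_gt0 ?prime_gt0 // => /eqP <-.
rewrite sum1dep_card /n_comp_mem; apply: eq_card => x.
by rewrite !inE dpE /roots /= andbCA andbA.
Qed.

End Counting.

(** * The number of twist isoclasses *)

Section TwistClasses.
Variables (R : realType) (s p N : nat) (hp : prime p) (hsp : (s.+2 <= p)%N).
Local Notation C := R[i].
Local Notation T := (@char_shift C).
Local Notation X := {ffun 'I_s.+1 -> 'I_(p ^ N)}.
Local Notation G := (Mgroup s.+2).
Local Notation f := (@exp_shift s p N hp).
Local Notation rep := (representation R G (p ^ N)).
Variables (z : C) (hz : (p ^ N).-primitive_root z).
Implicit Types x y : X.

Definition full_char x : nat -> C := char_cons (exp_char z x).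

Lemma full_char_rank x : char_of_rank s.+2 (full_char x).
Proof. exact/char_cons_rank/exp_char_rank. Qed.

Lemma full_char_iter x : iter (p ^ N) T (full_char x) = full_char x.
Proof.
apply/(char_shift_pfactorP N hp hsp (full_char_rank x)) => i.
exact: exp_char_pN.
Qed.

Definition exp_model x : rep := model (full_char_rank x) (full_char_iter x).

Lemma full_char_inj x : full_order x ->
  injective (fun j : 'I_(p ^ N) => iter j T (full_char x)).
Proof.
move=> /full_orderP px; apply: (@iter_pfactor_inj _ (char_of_rank s.+2)) => //.
- exact: char_shift_rank.
- exact: char_shift_inj.
- exact: full_char_rank.
- exact: full_char_iter.
move=> k kN; apply/(all_torsP hp hsp hz); [exact: ltnW|exact: px].
Qed.

Lemma exp_model_irreducible x : full_order x -> irreducible_repr (exp_model x).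
Proof. by move=> px; apply: model_irreducible; [exact: full_char_inj|exact: pN_gt0]. Qed.

Lemma exp_model_twist_inv x y : twist_equiv (exp_model x) (exp_model y) ->
  exists k, y = iter k f x.
Proof.
move=> /(model_twist_inv (pN_gt0 N hp))[k h]; exists k.
apply: (exp_char_inj hz); rewrite (exp_char_iter hp hz); apply/funext => i.
exact: etrans (h i) (esym (congr1 (@^~ i) (iter_char_shift_tail (full_char x) k))).
Qed.

(** The dimension p^N is the exact period of lam, so the tail consists of p^N-th roots of unity and
    has exponent exactly p^N; its logarithms to base z give x. *)
Lemma twist_equiv_exp_model (rho : rep) : irreducible_repr rho ->
  exists x, [/\ full_order x, froot f x == x & twist_equiv rho (exp_model x)].
Proof.
move=> irr; have [v [lam [v0 vE]]] := irreducible_eigenvector irr.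
have AB := Mtuple_repr rho; have irrW := irreducible_a_b irr.
have lR := eigenvalue_rank AB v0 vE.
have [lT lI _] := orbit_basis AB irrW v0 vE.
have lz i := proj1 (char_shift_pfactorP N hp hsp lR) lT i.
pose x : X := [ffun j : 'I_s.+1 => sval (prim_rootP hz (lz j))].
have xE : exp_char z x = fun i => lam i.+1.
  apply/funext => i; rewrite /exp_char; case: (ltnP i s.+1) => il.
    by rewrite (exponentE _ (Ordinal il)) ffunE; case: (prim_rootP hz (lz i)).
  by rewrite exponent_ge // expr0; case: lR => _ ->.
have xk k : char_cons (exp_char z (iter k f x)) =
    fun i => if i is j.+1 then iter k T lam i else 1.
  apply/funext => -[|i] //=.
  by rewrite (exp_char_iter hp hz) xE iter_char_shift_tail.
have prx : full_order x.
  apply/full_orderP => k kN; apply/negP => /(all_torsP hp hsp hz x (ltnW kN)) e.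
  have h := proj1 (char_shift_pfactorP k hp hsp (full_char_rank x)) e.
  have lk : iter (p ^ k) T lam = lam.
    by apply: (proj2 (char_shift_pfactorP k hp hsp lR)) => i; have := h i; rewrite /= xE.
  have lt : (p ^ k < p ^ N)%N by rewrite ltn_exp2l // prime_gt1.
  have [/eqP] := lI (Ordinal lt) (Ordinal (pN_gt0 N hp)) lk.
  by rewrite expn_eq0 gtn_eqF // prime_gt0.
have fprim k : full_order (iter k f x).
  by elim: k => //= k IH; rewrite (full_order_shift hp hsp hz).
have [k kE] : exists k, iter k f x = froot f x.
  exists (findex f x (froot f x)); apply: iter_findex; exact: connect_root.
exists (froot f x); split.
- by rewrite -kE.
- apply/eqP/root_root; exact/fconnect_sym/(exp_shift_inj (hp := hp) hz).
(* Replacing v by b^k v moves the tail along its orbit to the chosen representative. *)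
apply: (twist_equiv_model (v := iter k (mulmx (b_mx rho)) v) (lam := iter k T lam)) => //.
- exact: (iter_mulmx_neq0 AB).
- exact: (eigen_iter AB).
move=> i; by rewrite /full_char -kE xk.
Qed.

Definition orbit_reps : {set X} := [set x : X | full_order x & froot f x == x]%SET.

Lemma twist_isoclassesE : twist_isoclasses R G (p ^ N) =
  [set twist_isoclass (exp_model x) | x in [set` orbit_reps]].
Proof.
apply/seteqP; split=> [_ [rho irr <-]|_ [x xr <-]].
  have [x [px rx eqx]] := twist_equiv_exp_model irr.
  exists x; first by rewrite /= inE px.
  by apply/twist_isoclass_eq/twist_equiv_sym => //; exact: exp_model_irreducible.
exists (exp_model x) => //=; apply: exp_model_irreducible.
by move: xr; rewrite /= inE => /andP[].
Qed.

Lemma finite_twist_isoclasses : finite_set (twist_isoclasses R G (p ^ N)).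
Proof. by rewrite twist_isoclassesE; apply: finite_image; exact: finite_finset. Qed.

Lemma num_twist_isoclassesE : num_twist_isoclasses R G (p ^ N) =
  (\sum_(k < N.+1) pow_diff (p ^ s) k * pow_diff p (N - k))%N.
Proof.
rewrite -(card_orbit_reps hp hsp hz) -/orbit_reps /num_twist_isoclasses twist_isoclassesE.
rewrite fset_set_image; last exact: finite_finset.
have fsE x : (x \in fset_set [set` orbit_reps]) = (x \in orbit_reps).
  by rewrite in_fset_set; [rewrite mem_setE|exact: finite_finset].
rewrite card_in_imfset /= => [|x y]; last first.
  rewrite !fsE !inE => /andP[px /eqP rx] /andP[py /eqP ry].
  move/(twist_isoclass_eq (exp_model_irreducible px) (exp_model_irreducible py)).
  case/exp_model_twist_inv => k yE; rewrite -rx -ry yE.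
  apply/(fingraph.rootP (fconnect_sym (exp_shift_inj (hp := hp) hz))).
  exact: fconnect_iter.
rewrite cardE; apply/perm_size/uniq_perm; rewrite ?fset_uniq ?enum_uniq // => x.
by rewrite mem_enum -fsE.
Qed.

End TwistClasses.

(** * The generating series *)

Section CauchyProduct.
Variables (F : fieldType) (Q p : nat) (x : F).
Hypotheses (Q_gt0 : (0 < Q)%N) (p_gt0 : (0 < p)%N).

Definition pow_diff_term (a : nat) (k : nat) : F := (pow_diff a k)%:R * x ^+ k.

Local Notation A := (pow_diff_term Q).
Local Notation B := (pow_diff_term p).
Local Notation al := (Q%:R * x).
Local Notation be := (p%:R * x).

Definition zeta_coef N : nat := (\sum_(k < N.+1) pow_diff Q k * pow_diff p (N - k))%N.
Definition zeta_term N : F := (zeta_coef N)%:R * x ^+ N.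

Lemma pow_diff_term0 a : pow_diff_term a 0 = 1.
Proof. by rewrite /pow_diff_term /= expr0 mulr1. Qed.

Lemma pow_diff_termS a k : (0 < a)%N ->
  pow_diff_term a k.+1 = (a%:R * x - x) * (a%:R * x) ^+ k.
Proof.
move=> a0; rewrite /pow_diff_term /= natrB ?leq_pexp2l // !natrX exprMn !exprS.
ring.
Qed.

Lemma zeta_termE N : zeta_term N = \sum_(k < N.+1) A k * B (N - k).
Proof.
rewrite /zeta_term natr_sum mulr_suml; apply: eq_bigr => k _.
have kN : (k <= N)%N by rewrite -ltnS.
by rewrite natrM -[X in x ^+ X](subnKC kN) exprD mulrACA.
Qed.

Lemma zeta_term0 : zeta_term 0 = 1.
Proof. by rewrite zeta_termE big_ord1 !pow_diff_term0 mulr1. Qed.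

(** B_(j+1) = be B_j for j >= 1, but B_1 = be - x; the term - x A_N corrects the case j = 0. In
    generating functions: (1 - be t) Z(t) = (1 - x t) A(t). *)
Lemma zeta_termS N : zeta_term N.+1 = be * zeta_term N - x * A N + A N.+1.
Proof.
rewrite !zeta_termE big_ord_recr /= subnn pow_diff_term0 mulr1; congr (_ + _).
rewrite !big_ord_recr /= subnn subSnn pow_diff_term0 mulr1 pow_diff_termS // expr0 mulr1.
have -> : \sum_(i < N) A i * B (N.+1 - i) = be * \sum_(i < N) A i * B (N - i).
  rewrite mulr_sumr; apply: eq_bigr => i _; have iN := ltn_ord i.
  rewrite subSn ?(ltnW iN) // -(subnSK iN) !pow_diff_termS // exprS; ring.
by ring.
Qed.

Lemma sum_pow_diff_term M :
  (* The last summand makes the telescoped formula valid for the empty sum too, where A_0 = 1. *)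
  (1 - al) * \sum_(k < M) A k = 1 - x - A M + (M == 0)%N%:R * x.
Proof.
elim: M => [|M IH]; first by rewrite big_ord0 pow_diff_term0 eqxx /=; ring.
rewrite big_ord_recr /= mulrDr IH pow_diff_termS //.
case: M {IH} => [|M]; first by rewrite pow_diff_term0 expr0 eqxx /=; ring.
by rewrite pow_diff_termS // exprS /=; ring.
Qed.

Lemma sum_zeta_term M :
  (1 - be) * \sum_(N < M) zeta_term N = (1 - x) * (\sum_(k < M) A k) + A M - zeta_term M.
Proof.
elim: M => [|M IH]; first by rewrite !big_ord0 zeta_term0 pow_diff_term0; ring.
rewrite !big_ord_recr /= mulrDr IH zeta_termS; ring.
Qed.

(** An exact expression for the error: apart from a correction at M = 0, it is linear in the M-th
    terms, which tend to 0. *)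
Lemma sum_zeta_term_error M :
  (1 - al) * (1 - be) * \sum_(N < M) zeta_term N - (1 - x) ^+ 2 =
  (1 - al) * (A M - zeta_term M) - (1 - x) * (A M - (M == 0)%N%:R * x).
Proof.
have := sum_zeta_term M; have := sum_pow_diff_term M.
set SA := \sum_(k < M) _; set S := \sum_(N < M) _ => eA eS.
rewrite -mulrA eS mulrDr mulrDr mulrCA eA; ring.
Qed.

End CauchyProduct.

(** * Geometric decay of the error *)

Lemma exprn_le_double (R : realFieldType) (r : R) N : 0 <= r -> r ^+ N <= (2 * r) ^+ N.
Proof. by move=> r0; apply: lerXn2r; rewrite ?nnegrE; lra. Qed.

Lemma zeta_term_bound_step (R : realFieldType) (r : R) N : 0 <= r ->
  r * (4 * (2 * r) ^+ N) + r * (2 * r ^+ N) + 2 * r ^+ N.+1 <= 4 * (2 * r) ^+ N.+1.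
Proof.
move=> r0; have := ler_wpM2l r0 (exprn_le_double N r0); rewrite !exprS.
set a := r ^+ N; set b := (2 * r) ^+ N => h.
have {}h : r * a <= r * b by [].
nra.
Qed.

Section Bounds.
Variable R : realType.
Local Notation C := R[i].
Local Notation nrm := (@Normc.normc R).

Lemma normr_normc (w : C) : `|w| = (nrm w)%:C. Proof. by []. Qed.
Lemma normc_ge0 (w : C) : 0 <= nrm w. Proof. by rewrite -ler0c -normr_normc. Qed.
Lemma normcX (w : C) k : nrm (w ^+ k) = nrm w ^+ k.
Proof. by elim: k => [|k IH]; rewrite ?expr0 ?Normc.normc1 // !exprS Normc.normcM IH. Qed.
Lemma normcB (w v : C) : nrm (w - v) <= nrm w + nrm v.
Proof. by rewrite -(normcN v); exact: le_normcD. Qed.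
Lemma normc_nat k : nrm k%:R = k%:R :> R.
Proof. by rewrite normcMn Normc.normc1. Qed.

Variables (Q p : nat) (x : C) (rho : R).
Hypotheses (Q_gt0 : (0 < Q)%N) (p_gt0 : (0 < p)%N).
Hypotheses (rho_ge0 : 0 <= rho) (rho_le : rho <= 1 / 4).
Hypotheses (hx : nrm x <= rho) (hQ : nrm (Q%:R * x) <= rho).
Hypothesis hp : nrm (p%:R * x) <= rho.
Local Notation A := (pow_diff_term x Q).

Lemma pow_diff_term_bound k : nrm (A k) <= 2 * rho ^+ k.
Proof.
case: k => [|k]; first by rewrite pow_diff_term0 Normc.normc1 expr0; lra.
rewrite pow_diff_termS // Normc.normcM normcX exprS mulrA.
apply: ler_pM; rewrite ?normc_ge0 ?exprn_ge0 ?normc_ge0 //.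
  apply: le_trans (normcB _ _) _; apply: le_trans (lerD hQ hx) _; lra.
by rewrite lerXn2r // nnegrE ?normc_ge0.
Qed.

(** Doubling the ratio absorbs the N + 1 summands of the convolution, and lets the recurrence
    [zeta_termS] close by induction. *)
Lemma zeta_term_bound N : nrm (zeta_term Q p x N) <= 4 * (2 * rho) ^+ N.
Proof.
elim: N => [|N IH]; first by rewrite zeta_term0 Normc.normc1 expr0; lra.
rewrite zeta_termS //.
have h1 : nrm (p%:R * x * zeta_term Q p x N - x * A N) <=
    rho * (4 * (2 * rho) ^+ N) + rho * (2 * rho ^+ N).
  apply: le_trans (normcB _ _) _.
  rewrite (Normc.normcM x) (Normc.normcM (p%:R * x)); apply: lerD.
    by apply: ler_pM; rewrite ?normc_ge0.
  by apply: ler_pM; rewrite ?normc_ge0 //; exact: pow_diff_term_bound.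
have h2 := pow_diff_term_bound N.+1.
apply: le_trans (le_trans (le_normcD _ _) (lerD h1 h2)) _.
exact: zeta_term_bound_step.
Qed.

Lemma sum_zeta_term_bound M :
  nrm ((1 - Q%:R * x) * (1 - p%:R * x) * (\sum_(N < M) zeta_term Q p x N) -
    (1 - x) ^+ 2)
  <= 20 * (2 * rho) ^+ M.
Proof.
rewrite sum_zeta_term_error //.
have r2 : 1 + rho <= 2 by move: rho_le; lra.
have r1 : rho <= 2 * 1 by move: rho_le; lra.
have rM := exprn_le_double M rho_ge0.
have rM0 : 0 <= 2 * (2 * rho) ^+ M by rewrite mulr_ge0 // exprn_ge0 // mulr_ge0.
have b1 (w : C) : nrm w <= rho -> nrm (1 - w) <= 2.
  move=> hw; apply: le_trans (normcB _ _) _.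
  by apply: le_trans (lerD (lexx _) hw) _; rewrite Normc.normc1.
have hA := pow_diff_term_bound M; have hZ := zeta_term_bound M.
have hM : nrm ((M == 0)%N%:R * x) <= 2 * (2 * rho) ^+ M.
  rewrite Normc.normcM normc_nat; case: eqP => [->|_]; last by rewrite mul0r.
  by rewrite mul1r expr0; apply: le_trans hx r1.
have e1 : nrm (1 - Q%:R * x) * nrm (A M - zeta_term Q p x M) <=
    2 * (6 * (2 * rho) ^+ M).
  apply: ler_pM; rewrite ?normc_ge0 ?b1 //.
  apply: le_trans (le_trans (normcB _ _) (lerD hA hZ)) _.
  by move: rM; move: (rho ^+ M) ((2 * rho) ^+ M) => a b; lra.
have e2 : nrm (1 - x) * nrm (A M - (M == 0)%N%:R * x) <= 2 * (4 * (2 * rho) ^+ M).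
  apply: ler_pM; rewrite ?normc_ge0 ?b1 //.
  apply: le_trans (le_trans (normcB _ _) (lerD hA hM)) _.
  by move: rM; move: (rho ^+ M) ((2 * rho) ^+ M) => a b; lra.
apply: le_trans (normcB _ _) _; rewrite 2!Normc.normcM.
apply: le_trans (lerD e1 e2) _.
by move: ((2 * rho) ^+ M) => b; lra.
Qed.

Lemma cvg_complex_geometric (u : C^nat) (l : C) (c r : R) : 0 <= r < 1 ->
  (forall M, nrm (u M - l) <= c * r ^+ M) ->
  (u : (C^o)^nat) @ \oo --> (l : C^o).
Proof.
(* The norm of C takes values in C, so e is a positive complex number, replaced by its real part. *)
move=> /andP[r0 r1] h; apply/cvgrPdist_lt => e e0.
have eE : e = (complex.Re e)%:C by rewrite RRe_real // gtr0_real.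
have Re0 : 0 < complex.Re e by rewrite -ltcR -eE.
have r1' : `|r| < 1 by rewrite ger0_norm.
have hN := (cvgr0Pnorm_lt (geometric c r : nat -> R^o)).1 (cvg_geometric c r1') _ Re0.
near=> M; rewrite distrC -[X in X < _]normr_normc eE ltcR (le_lt_trans (h M)) //.
apply: le_lt_trans (ler_norm _) _.
by near: M; exact: hN.
Unshelve. all: by end_near.
Qed.

End Bounds.

(** * Complex powers of p *)

Section ComplexExp.
Variable R : realType.
Implicit Types a b : R[i].

Lemma cexpD a b : cexp (a + b) = cexp a * cexp b.
Proof.
case: a b => [x1 y1] [x2 y2]; rewrite /cexp /= expRD cosD sinD.
by apply/eqP; rewrite eq_complex /=; apply/andP; split; apply/eqP; ring.
Qed.

Lemma cexp0 : cexp (0 : R[i]) = 1.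
Proof. by rewrite /cexp /= expR0 cos0 sin0 mul1r. Qed.

Lemma cexp_natM k a : cexp (k%:R * a) = cexp a ^+ k.
Proof.
elim: k => [|k IH]; first by rewrite mul0r cexp0 expr0.
by rewrite -add1n natrD mulrDl mul1r cexpD IH exprS.
Qed.

Lemma cexp_ln k : (0 < k)%N -> cexp (ln (k%:R : R))%:C = k%:R.
Proof.
move=> k0; rewrite /cexp /= lnK ?posrE ?ltr0n // cos0 sin0.
by rewrite -[1 +i* 0]/(1%:C) rmorph1 mulr1 rmorph_nat.
Qed.

Lemma normc_cexp a : Normc.normc (cexp a) = expR (complex.Re a).
Proof.
rewrite /cexp Normc.normcM /= !expr0n /= addr0 cos2Dsin2 sqrtr1 mulr1.
by rewrite sqrtr_sqr ger0_norm // expR_ge0.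
Qed.

Lemma cpow_shift (p k : nat) (s : R[i]) : (0 < p)%N ->
  cpow p (k%:R - s) = p%:R ^+ k * cpow p (- s).
Proof. by move=> p0; rewrite /cpow mulrDl cexpD cexp_natM cexp_ln. Qed.

Lemma cpow_mulrn (p k : nat) (s : R[i]) : cpow p (- (k%:R * s)) = cpow p (- s) ^+ k.
Proof. by rewrite /cpow -mulrN -mulrA cexp_natM. Qed.

Lemma normc_cpow (p : nat) (s : R[i]) :
  Normc.normc (cpow p (- s)) = expR (- complex.Re s * ln p%:R).
Proof. by rewrite /cpow normc_cexp; case: s => a b /=; rewrite mulr0 subr0. Qed.

(** The quantity is p^(k - Re s), which is at most p^(-2), hence at most 1/4. *)
Lemma normc_cpow_small (p k : nat) (s : R[i]) : (1 < p)%N -> (k.+2)%:R < complex.Re s ->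
  p%:R ^+ k * Normc.normc (cpow p (- s)) <= 1 / 4.
Proof.
move=> p1 ks; have p0 : (0 < p)%N by rewrite ltnW.
have lnp : 0 <= ln (p%:R : R) by rewrite ln_ge0 // ler1n.
have pE j : p%:R ^+ j = expR (j%:R * ln (p%:R : R)).
  by rewrite mulrC expRM_natr lnK // posrE ltr0n.
have : p%:R ^+ 2 * (p%:R ^+ k * Normc.normc (cpow p (- s))) <= 1.
  rewrite mulrA -exprD normc_cpow pE -expRD -[X in _ <= X]expR0 ler_expR -mulrDl.
  by rewrite mulr_le0_ge0 // add2n subr_le0 ltW.
set t := _ * Normc.normc _; have t0 : 0 <= t.
  by rewrite mulr_ge0 ?exprn_ge0 // normc_ge0.
have : (2 : R) <= p%:R by rewrite ler_nat.
move: t t0 (p%:R : R) => t t0 q q2; rewrite expr2 => h.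
have q4 : 4 <= q * q by nra.
have := ler_wpM2r t0 q4; lra.
Qed.

End ComplexExp.

Theorem mainTheorem1 (R : realType) (n p : nat) (hn : (2 <= n)%N)
    (hp : prime p) (hpn : (n <= p)%N) :
  (forall N : nat, finite_set (twist_isoclasses R (Mgroup n) (p ^ N))) /\
  exists sigma0 : R, forall s : R[i], sigma0 < complex.Re s ->
    cvgn (series (zeta_irr_terms (Mgroup n) p s)) /\
    zeta_irr (Mgroup n) p s =
      (1 - cpow p (- s)) ^+ 2 /
      ((1 - cpow p ((n%:R - 2) - s)) * (1 - cpow p (1 - s))).
Proof.
case: n hn hpn => [|[|n]] // _ hpn.
have pN0 N : (0 < p ^ N)%N by rewrite expn_gt0 prime_gt0.
have p0 := prime_gt0 hp; have p1 := prime_gt1 hp.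
split=> [N|].
  have [z hz] := closed_prim_root_exists R[i] (pN0 N).
  exact (finite_twist_isoclasses hp hpn hz).
(* Here n stands for the original n minus 2. The bound is [normc_cpow_small] at exponent n + 1,
   which dominates the exponents 0, 1 and n of p in x, p x and p^n x. *)
exists n.+3%:R => s hs.
set x := cpow p (- s).
have -> : cpow p (1 - s) = p%:R * x by rewrite (cpow_shift 1) // expr1.
have -> : cpow p (n.+2%:R - 2 - s) = (p ^ n)%N%:R * x.
  by rewrite -[n.+2]addn2 natrD addrK cpow_shift // natrX.
have termE : zeta_irr_terms (Mgroup n.+2) p s = zeta_term (p ^ n) p x.
  apply/funext => N; rewrite /zeta_irr_terms /zeta_term cpow_mulrn.
  have [z hz] := closed_prim_root_exists R[i] (pN0 N).
  by rewrite (num_twist_isoclassesE hp hpn hz).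
pose rho := p%:R ^+ n.+1 * Normc.normc x.
have x_ge0 := normc_ge0 x.
have rho0 : 0 <= rho by rewrite mulr_ge0 // exprn_ge0.
have rho4 : rho <= 1 / 4 by exact: normc_cpow_small.
have hk k : (k <= n.+1)%N -> Normc.normc ((p ^ k)%N%:R * x) <= rho.
  move=> kn; rewrite Normc.normcM normc_nat natrX ler_wpM2r //.
  by rewrite ler_weXn2l // ler1n.
have hx : Normc.normc x <= rho by have := hk 0%N isT; rewrite expn0 mul1r.
have hQ : Normc.normc ((p ^ n)%N%:R * x) <= rho by exact: hk.
have hp' : Normc.normc (p%:R * x) <= rho by have := hk 1%N isT; rewrite expn1.
have neq0 (w : R[i]) : Normc.normc w <= rho -> 1 - w != 0.
  move=> hw; rewrite subr_eq0; apply/eqP => w1; move: hw; rewrite -w1 Normc.normc1.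
  by move: rho4; lra.
set D := (1 - _) * (1 - _).
have D0 : D != 0 by rewrite mulf_neq0 ?neq0.
(* Dividing the error of [sum_zeta_term_bound] by the nonzero D gives convergence with ratio 2 rho,
   at most 1/2. *)
have cv : (series (zeta_irr_terms (Mgroup n.+2) p s) : (R[i]^o)^nat) @ \oo -->
    ((1 - x) ^+ 2 / D : R[i]^o).
  apply: (@cvg_complex_geometric R _ _ (20 / Normc.normc D) (2 * rho)).
    by move: rho0 rho4; clear; lra.
  move=> M; rewrite /series /= big_mkord termE.
  have := sum_zeta_term_bound (pN0 n) p0 rho0 rho4 hx hQ hp' M.
  rewrite -/D; set S := \sum_(N < M) _.
  have -> : S - (1 - x) ^+ 2 / D = (D * S - (1 - x) ^+ 2) / D by field.
  rewrite [Normc.normc (_ / D)]Normc.normcM Normc.normcV => h.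
  rewrite [X in _ <= X]mulrAC ler_wpM2r // invr_ge0; exact: normc_ge0.
split; first by apply/cvg_ex; exists ((1 - x) ^+ 2 / D).
exact: (cvg_lim (@norm_hausdorff _ _) cv).
Qed.
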